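(* The $\mathbb{K}$-algebras $(H,\sqcup\!\sqcup_{\square},+)$, $(H,\sqcup\!\sqcup,+)$ and $(H,\sqcup\!\sqcup^{\mathsf{qs}},+)$ (block shuffle, two-parameter shuffle, and two-parameter quasi-shuffle algebra on matrix compositions) are isomorphic: $(H,\sqcup\!\sqcup_{\square},+)\cong(H,\sqcup\!\sqcup,+)\cong(H,\sqcup\!\sqcup^{\mathsf{qs}},+)$ as $\mathbb{K}$-algebras.
   Context: $\mathbb{K}$ is a commutative $\mathbb{Q}$-algebra, $d\ge 1$, and $(\mathfrak{M}_d,\star,\varepsilon)$ is the free commutative monoid generated by $d$ letters, with neutral element $\varepsilon$. A matrix composition is either the empty composition $\mathsf{e}$ (with $0$ rows and $0$ columns) or a matrix of size $m\times n$, $m,n\ge 1$, with entries in $\mathfrak{M}_d$ having no row and no column consisting only of $\varepsilon$. $\mathrm{Comp}$ is the set of matrix compositions and $H=\bigoplus_{\mathbf{a}\in\mathrm{Comp}}\mathbb{K}\mathbf{a}$. For $\mathbf{a},\mathbf{b}\in\mathrm{Comp}$, $\mathrm{diag}(\mathbf{a},\mathbf{b})$ is the block diagonal matrix with blocks $\mathbf{a},\mathbf{b}$ and all off-diagonal-block entries equal to $\varepsilon$; $\mathsf{e}$ is neutral for $\mathrm{diag}$; $\mathrm{diag}$ is extended bilinearly to $H$. A nonempty $\mathbf{c}\in\mathrm{Comp}$ is connected if $\mathbf{c}=\mathrm{diag}(\mathbf{a},\mathbf{b})$ implies $\mathbf{a}=\mathsf{e}$ or $\mathbf{b}=\mathsf{e}$.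 Every nonempty composition is uniquely $\mathrm{diag}(\mathbf{u}_1,\dots,\mathbf{u}_\ell)$ with all $\mathbf{u}_i$ connected. Products on $H$ (all bilinear with neutral element $\mathsf{e}$): (1) Block shuffle $\sqcup\!\sqcup_{\square}$: $\mathrm{diag}(\mathbf{a},\mathbf{u})\sqcup\!\sqcup_{\square}\mathrm{diag}(\mathbf{b},\mathbf{v})=\mathrm{diag}(\mathbf{a},\mathbf{u}\sqcup\!\sqcup_{\square}\mathrm{diag}(\mathbf{b},\mathbf{v}))+\mathrm{diag}(\mathbf{b},\mathrm{diag}(\mathbf{a},\mathbf{u})\sqcup\!\sqcup_{\square}\mathbf{v})$ for connected $\mathbf{a},\mathbf{b}$ and $\mathbf{u},\mathbf{v}\in\mathrm{Comp}$. (2) Two-parameter shuffle $\sqcup\!\sqcup$: for nonempty $\mathbf{a}$ (size $m\times n$), $\mathbf{b}$ (size $s\times t$), $\mathbf{a}\sqcup\!\sqcup\mathbf{b}=\sum_{p\in\mathrm{sh}(m,s)}\sum_{q\in\mathrm{sh}(n,t)}(\mathrm{diag}(\mathbf{a},\mathbf{b})_{p^{-1}(u),q^{-1}(v)})_{u,v}$, where $\mathrm{sh}(m,s)$ is the set of permutations $q$ of $\{1,\dots,m+s\}$ with $q(1)<\dots<q(m)$ and $q(m+1)<\dots<q(m+s)$. (3) Two-parameter quasi-shuffle $\sqcup\!\sqcup^{\mathsf{qs}}$: for nonempty $\mathbf{a}$ (size $m\times n$), $\mathbf{b}$ (size $s\times t$), $\mathbf{a}\sqcup\!\sqcup^{\mathsf{qs}}\mathbf{b}=\sum_{j,k\ge1}\sum_{p\in\mathrm{qsh}(m,s;j)}\sum_{q\in\mathrm{qsh}(n,t;k)}\mathbf{c}^{p,q}$,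 where $\mathbf{c}^{p,q}$ is the $j\times k$ matrix with entries $\mathbf{c}^{p,q}_{x,y}=\bigstar_{u\in p^{-1}(x),\,v\in q^{-1}(y)}\mathrm{diag}(\mathbf{a},\mathbf{b})_{u,v}$, and $\mathrm{qsh}(m,s;j)$ is the set of surjections $q:\{1,\dots,m+s\}\to\{1,\dots,j\}$ with $q(1)<\dots<q(m)$ and $q(m+1)<\dots<q(m+s)$. Each of these makes $H$ a commutative associative unital $\mathbb{K}$-algebra. *)

(* Defs.v *)
From HB Require Import structures.
From mathcomp Require Import all_boot all_order all_fingroup all_algebra.
From mathcomp Require Import zify finmap boolp.
From mathcomp Require Import monalg.

Set Implicit Arguments.
Unset Strict Implicit.
Unset Printing Implicit Defensive.

Import GRing.Theory.
Local Open Scope ring_scope.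

Section BilinearExtension.
Context (K : nzRingType) (C : choiceType) (V : lmodType K).

Definition bilin (f : C -> C -> V) (x y : {malg K[C]}) : V :=
  \sum_(a <- msupp x) \sum_(b <- msupp y) (x@_a * y@_b) *: f a b.

Lemma bilinU f a b : bilin f << a >> << b >> = f a b.
Proof.
have E (c : C) : msupp (<< c >> : {malg K[C]}) = [fset c]%fset.
  by rewrite msuppU oner_eq0.
by rewrite /bilin (E a) (E b) !big_seq_fset1 !mcoeffUU mulr1 scale1r.
Qed.

End BilinearExtension.

Section MatrixCompositions.
Context (d : nat).

(* The free commutative monoid on d letters, with product [mmul] and neutral
   element [mone]. *)
Local Notation M := (cmonom 'I_d).
Local Notation eps := (@mone M).

(* For m = 0 or n = 0 this forces m = n = 0, so the empty composition is the
   only degenerate matrix that is accepted. *)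
Definition no_eps_line m n (A : 'M[M]_(m, n)) : bool :=
  [forall i, exists j, A i j != eps] && [forall j, exists i, A i j != eps].

Lemma no_eps_lineP m n (A : 'M[M]_(m, n)) :
  reflect ((forall i, exists j, A i j != eps) /\
           (forall j, exists i, A i j != eps)) (no_eps_line A).
Proof.
apply: (iffP andP) => -[hr hc]; split.
- by move=> i; apply/existsP/(forallP hr).
- by move=> j; apply/existsP/(forallP hc).
- by apply/forallP=> i; apply/existsP/hr.
- by apply/forallP=> j; apply/existsP/hc.
Qed.

Record mcomp := Comp {
  comp_val : {mn : nat * nat & 'M[M]_(mn.1, mn.2)};
  _ : no_eps_line (tagged comp_val) }.

HB.instance Definition _ := [isSub for comp_val].
(* Opaque equality and choice: unification would otherwise unfold the matrix
   comparison when it compares basis elements of the free module. *)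
HB.instance Definition _ := gen_eqMixin mcomp.
HB.instance Definition _ := gen_choiceMixin mcomp.

Definition mkcomp m n (A : 'M[M]_(m, n)) (hA : no_eps_line A) : mcomp :=
  @Comp (@Tagged _ (m, n) (fun mn => 'M[M]_(mn.1, mn.2)) A) hA.

Definition nrow (c : mcomp) : nat := (tag (comp_val c)).1.
Definition ncol (c : mcomp) : nat := (tag (comp_val c)).2.
Definition comp_mx (c : mcomp) : 'M[M]_(nrow c, ncol c) := tagged (comp_val c).

Lemma comp_mxP (c : mcomp) : no_eps_line (comp_mx c).
Proof. by case: c. Qed.

Lemma no_eps_line0 : no_eps_line (const_mx eps : 'M[M]_(0, 0)).
Proof. by apply/no_eps_lineP; split=> -[]. Qed.

Definition cempty : mcomp := mkcomp no_eps_line0.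

Definition diag_mx2 m n s t (A : 'M[M]_(m, n)) (B : 'M[M]_(s, t)) :
  'M[M]_(m + s, n + t) := block_mx A (const_mx eps) (const_mx eps) B.

Lemma no_eps_line_diag m n s t (A : 'M[M]_(m, n)) (B : 'M[M]_(s, t)) :
  no_eps_line A -> no_eps_line B -> no_eps_line (diag_mx2 A B).
Proof.
move=> /no_eps_lineP[rA cA] /no_eps_lineP[rB cB].
apply/no_eps_lineP; split=> k; case: (split_ordP k) => i ->.
- by have [j h] := rA i; exists (lshift t j); rewrite block_mxEul.
- by have [j h] := rB i; exists (rshift n j); rewrite block_mxEdr.
- by have [j h] := cA i; exists (lshift s j); rewrite block_mxEul.
- by have [j h] := cB i; exists (rshift m j); rewrite block_mxEdr.
Qed.

Definition diag (a b : mcomp) : mcomp :=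
  mkcomp (no_eps_line_diag (comp_mxP a) (comp_mxP b)).

Definition connected (c : mcomp) : Prop :=
  c <> cempty /\ forall a b, c = diag a b -> a = cempty \/ b = cempty.

Definition bigdiag (s : seq mcomp) : mcomp := foldr diag cempty s.

(* Entries indexed by pairs of natural numbers, with value eps outside of the
   matrix; compositions are equal as soon as their sizes and entries are. *)
Definition entry (c : mcomp) (i j : nat) : M :=
  if insub i is Some i' then
    if insub j is Some j' then comp_mx c i' j' else eps
  else eps.

Lemma entryE (c : mcomp) (i : 'I_(nrow c)) (j : 'I_(ncol c)) :
  entry c i j = comp_mx c i j.
Proof. by rewrite /entry !valK. Qed.

Lemma entry_row (c : mcomp) i j : (nrow c <= i)%N -> entry c i j = eps.
Proof. by move=> h; rewrite /entry insubF // ltnNge h. Qed.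

Lemma entry_col (c : mcomp) i j : (ncol c <= j)%N -> entry c i j = eps.
Proof.
by move=> h; rewrite /entry; case: insub => // i'; rewrite insubF // ltnNge h.
Qed.

Lemma comp_eq (a b : mcomp) :
  nrow a = nrow b -> ncol a = ncol b -> entry a =2 entry b -> a = b.
Proof.
move=> hr hc he; apply: val_inj.
have: forall (i : 'I_(nrow a)) (j : 'I_(ncol a)),
    comp_mx a i j = entry b i j by move=> i j; rewrite -he entryE.
rewrite /entry {he}; move: hr hc; rewrite /comp_mx /nrow /ncol /=.
case: a b => [[[m n] A] hA] [[[s t] B] hB] /= hr hc.
case: s / hr B hB => B hB; case: t / hc B hB => B hB /= he.
by congr (Tagged _ _); apply/matrixP=> i j; rewrite he !valK.
Qed.

Lemma row_entry (c : mcomp) i :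
  (i < nrow c)%N -> exists2 j, (j < ncol c)%N & entry c i j != eps.
Proof.
move=> h; have [/(_ (Ordinal h))[j hj] _] := no_eps_lineP _ (comp_mxP c).
by exists j => //; rewrite -[i]/(val (Ordinal h)) entryE.
Qed.

Lemma col_entry (c : mcomp) j :
  (j < ncol c)%N -> exists2 i, (i < nrow c)%N & entry c i j != eps.
Proof.
move=> h; have [_ /(_ (Ordinal h))[i hi]] := no_eps_lineP _ (comp_mxP c).
by exists i => //; rewrite -[j]/(val (Ordinal h)) entryE.
Qed.

Lemma nrow_eq0 (c : mcomp) : nrow c = 0%N -> c = cempty.
Proof.
move=> hr; have hc : ncol c = 0%N.
  case: (posnP (ncol c)) => // /col_entry[i]; by rewrite hr.
by apply: comp_eq => // i j; rewrite !entry_row // hr.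
Qed.

Lemma entry_diag (a b : mcomp) i j : entry (diag a b) i j =
  if (i < nrow a)%N && (j < ncol a)%N then entry a i j
  else if (nrow a <= i)%N && (ncol a <= j)%N
       then entry b (i - nrow a) (j - ncol a) else eps.
Proof.
case: (ltnP i (nrow a + nrow b)) => hi; last first.
  have ha := leq_trans (leq_addr (nrow b) (nrow a)) hi.
  rewrite entry_row // ltnNge ha /=; case: ifP => // _.
  by rewrite entry_row // leq_subRL.
case: (ltnP j (ncol a + ncol b)) => hj; last first.
  have ha := leq_trans (leq_addr (ncol b) (ncol a)) hj.
  rewrite entry_col // [(j < _)%N]ltnNge ha andbF /=; case: ifP => // _.
  by rewrite entry_col // leq_subRL.
suff key (i' : 'I_(nrow a + nrow b)) (j' : 'I_(ncol a + ncol b)) :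
    entry (diag a b) i' j' =
    if (i' < nrow a)%N && (j' < ncol a)%N then entry a i' j'
    else if (nrow a <= i')%N && (ncol a <= j')%N
         then entry b (i' - nrow a) (j' - ncol a) else eps.
  exact: (key (Ordinal hi) (Ordinal hj)).
rewrite (@entryE (diag a b)).
rewrite /comp_mx /= /diag_mx2.
case: (split_ordP i') => k ->; case: (split_ordP j') => l -> /=;
  rewrite ?block_mxEul ?block_mxEur ?block_mxEdl ?block_mxEdr ?mxE;
  rewrite ?ltn_ord ?entryE //=.
- by rewrite [(_ <= k)%N]leqNgt ltn_ord.
- by rewrite [(_ <= l)%N]leqNgt ltn_ord andbF.
- by rewrite !leq_addr /= !addKn entryE.
Qed.

Lemma diag0c (c : mcomp) : diag cempty c = c.
Proof.
by apply: comp_eq => // i j; rewrite entry_diag /= !subn0.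
Qed.

Lemma diagc0 (c : mcomp) : diag c cempty = c.
Proof.
apply: comp_eq; rewrite ?[nrow (diag _ _)]addn0 ?[ncol (diag _ _)]addn0 //.
move=> i j; rewrite entry_diag; case: ifP => //.
rewrite [entry cempty _ _]entry_row // if_same.
by case: ltnP => h /=; [case: ltnP => // h' _; rewrite entry_col|
  rewrite entry_row].
Qed.

Lemma diagA : associative diag.
Proof.
move=> a b c; apply: comp_eq; [exact: addnA | exact: addnA | move=> i j].
have [rE cE] : nrow (diag a b) = (nrow a + nrow b)%N /\
  ncol (diag a b) = (ncol a + ncol b)%N by [].
rewrite !entry_diag rE cE !subnDA.
by do !case: ifP => //; lia.
Qed.

Lemma bigdiag_cat s t : bigdiag (s ++ t) = diag (bigdiag s) (bigdiag t).
Proof. by elim: s => [|a s IHs] /=; rewrite ?diag0c // IHs diagA. Qed.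

Lemma exists_components (c : mcomp) :
  exists s : seq mcomp, (forall u, u \in s -> connected u) /\ bigdiag s = c.
Proof.
have [n] := ubnP (nrow c); elim: n c => // n IHn c hn.
have [-> | c0] := pselect (c = cempty); first by exists [::].
have [cc | nc] := pselect (connected c).
  by exists [:: c]; split=> [u|]; [rewrite inE => /eqP-> | exact: diagc0].
have [a [b [cE a0 b0]]] : exists a b, [/\ c = diag a b, a <> cempty & b <> cempty].
  apply: contrapT => H; apply: nc; split=> // a b cE.
  have [|a0] := pselect (a = cempty); first by left.
  have [|b0] := pselect (b = cempty); first by right.
  by case: H; exists a, b.
have pos x : x <> cempty -> (0 < nrow x)%N.
  by move=> h; rewrite lt0n; apply: contra_notN h => /eqP/nrow_eq0.
have hE : nrow c = (nrow a + nrow b)%N by rewrite cE.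
have [ha hb] := (pos _ a0, pos _ b0).
have [s [hs sE]] := IHn a ltac:(lia).
have [t [ht tE]] := IHn b ltac:(lia).
exists (s ++ t); rewrite bigdiag_cat sE tE cE; split=> // u.
by rewrite mem_cat => /orP[/hs|/ht].
Qed.

(* The connected components of c, from top left to bottom right. *)
Definition components (c : mcomp) : seq mcomp := sval (cid (exists_components c)).

Lemma components_connected c u : u \in components c -> connected u.
Proof. exact: (svalP (cid (exists_components c))).1. Qed.

Lemma bigdiag_components c : bigdiag (components c) = c.
Proof. exact: (svalP (cid (exists_components c))).2. Qed.

Lemma connected_diag_inj a b u v :
  connected a -> connected b -> diag a u = diag b v -> a = b /\ u = v.
Proof.
wlog le_ab : a b u v / (nrow a <= nrow b)%N.
  move=> H ca cb E; case: (leqP (nrow a) (nrow b)) => h; first exact: H.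
  by have [||//||-> ->] := H b a v u; rewrite // ltnW.
move=> [a0 _] cb E.
have hE i j := congr1 (fun c => entry c i j) E.
have lec_ab : (ncol a <= ncol b)%N.
  rewrite leqNgt; apply/negP=> h; have [i hi] := col_entry h.
  move: (hE i (ncol b)); rewrite !entry_diag hi h (leq_trans hi le_ab) ltnn /=.
  by rewrite [(_ <= i)%N]leqNgt (leq_trans hi le_ab) /= => ->; rewrite eqxx.
pose W : 'M[M]_(nrow b - nrow a, ncol b - ncol a) :=
  \matrix_(i, j) entry b (nrow a + i) (ncol a + j).
have hW : no_eps_line W.
  apply/no_eps_lineP; split=> k.
  - have hk : (nrow a + k < nrow b)%N by have := ltn_ord k; lia.
    have [j hj hne] := row_entry hk.
    have haj : (ncol a <= j)%N.
      rewrite leqNgt; apply: contraNN hne => h.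
      move: (hE (nrow a + k)%N j); rewrite !entry_diag hk hj /= => <-.
      by rewrite ltnNge leq_addr /= leqNgt h.
    have hj' : (j - ncol a < ncol b - ncol a)%N by lia.
    by exists (Ordinal hj'); rewrite mxE /= subnKC.
  - have hk : (ncol a + k < ncol b)%N by have := ltn_ord k; lia.
    have [i hi hne] := col_entry hk.
    have hai : (nrow a <= i)%N.
      rewrite leqNgt; apply: contraNN hne => h.
      move: (hE i (ncol a + k)%N); rewrite !entry_diag hk hi /= => <-.
      by rewrite [(ncol a + k < _)%N]ltnNge leq_addr andbF /= leqNgt h.
    have hi' : (i - nrow a < nrow b - nrow a)%N by lia.
    by exists (Ordinal hi'); rewrite mxE /= subnKC.
pose w := mkcomp hW.
have wE i j : entry w i j = entry b (nrow a + i) (ncol a + j).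
  have [hi|hi] := ltnP i (nrow b - nrow a); last first.
    by rewrite !entry_row //; lia.
  have [hj|hj] := ltnP j (ncol b - ncol a); last first.
    by rewrite !entry_col //; lia.
  have := entryE (c := w) (Ordinal hi) (Ordinal hj).
  by rewrite /= => ->; rewrite mxE.
have bE : b = diag a w.
  apply: comp_eq; [by apply/esym/subnKC | by apply/esym/subnKC | move=> i j].
  rewrite [RHS]entry_diag wE; move: (hE i j); rewrite !entry_diag.
  have [hi|hi] := ltnP i (nrow b); last first.
    have -> : (i < nrow a)%N = false by lia.
    by rewrite !(@entry_row b) ?if_same //; lia.
  have [hj|hj] := ltnP j (ncol b); last first.
    have -> : (j < ncol a)%N = false by lia.
    by rewrite andbF !(@entry_col b) ?if_same //; lia.
  case: ((i < nrow a)%N && (j < ncol a)%N) => /=; first by move->.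
  by case: (boolP ((nrow a <= i)%N && _)) => [/andP[h1 h2] _|_ <-] //;
    rewrite !subnKC.
have [//|w0] := cb.2 _ _ bE.
have ab : a = b by rewrite bE w0 diagc0.
rewrite -ab in E hE; split=> //; apply: comp_eq.
- by have /addnI := congr1 nrow E.
- by have /addnI := congr1 ncol E.
move=> i j; move: (hE (nrow a + i)%N (ncol a + j)%N).
by rewrite !entry_diag ltnNge !leq_addr /= !addKn.
Qed.

Lemma components_cempty : components cempty = [::].
Proof.
have := bigdiag_components cempty; have := @components_connected cempty.
case: components => // x s hs /(congr1 nrow)/eqP.
rewrite addn_eq0 => /andP[/eqP/nrow_eq0 x0 _].
by have [] := hs x (mem_head _ _).
Qed.

Lemma components_diag a u :
  connected a -> components (diag a u) = a :: components u.
Proof.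
move=> ca; have H s t : (forall x, x \in s -> connected x) ->
    (forall x, x \in t -> connected x) -> bigdiag s = bigdiag t -> s = t.
  have nil x y : x <> cempty -> cempty <> diag x y.
    move=> x0 /(congr1 nrow)/esym/eqP; rewrite addn_eq0 => /andP[/eqP h _].
    exact/x0/nrow_eq0.
  elim: s t => [|x s IHs] [|y t] //= hs ht.
  - by case/nil; have [] := ht y (mem_head _ _).
  - by move/esym; case/nil; have [] := hs x (mem_head _ _).
  - move=> /connected_diag_inj[||-> /IHs->] //.
    + exact/hs/mem_head.
    + exact/ht/mem_head.
    + by move=> z hz; apply: hs; rewrite inE hz orbT.
    + by move=> z hz; apply: ht; rewrite inE hz orbT.
apply: H; first exact: components_connected.
  by move=> x; rewrite inE => /orP[/eqP->|/components_connected].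
by rewrite /= !bigdiag_components.
Qed.

(* f is increasing on the first m indices and on the last s indices. *)
Definition incr_blocks m s k (f : 'I_(m + s) -> 'I_k) : bool :=
  [forall i : 'I_m, forall j : 'I_m,
     (i < j)%N ==> (f (lshift s i) < f (lshift s j))%N] &&
  [forall i : 'I_s, forall j : 'I_s,
     (i < j)%N ==> (f (rshift m i) < f (rshift m j))%N].

Definition sh m s : {set 'S_(m + s)} := [set p : 'S_(m + s) | incr_blocks p].

Lemma no_eps_line_perm m n (A : 'M[M]_(m, n)) (p : 'S_m) (q : 'S_n) :
  no_eps_line A -> no_eps_line (\matrix_(u, v) A (p^-1 u)%g (q^-1 v)%g).
Proof.
move=> /no_eps_lineP[hr hc]; apply/no_eps_lineP; split=> k.
- by have [j h] := hr (p^-1 k)%g; exists (q j); rewrite mxE permK.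
- by have [i h] := hc (q^-1 k)%g; exists (p i); rewrite mxE permK.
Qed.

Definition perm_diag (a b : mcomp) (p : 'S_(nrow a + nrow b))
    (q : 'S_(ncol a + ncol b)) : mcomp :=
  mkcomp (no_eps_line_perm p q (comp_mxP (diag a b))).

Definition surjb m k (f : 'I_m -> 'I_k) : bool :=
  [forall x, exists u, f u == x].

Definition qsh m s j : predArgType :=
  {q : {ffun 'I_(m + s) -> 'I_j} | incr_blocks q && surjb q}.

Definition merge_mx m n j k (A : 'M[M]_(m, n)) (p : 'I_m -> 'I_j)
    (q : 'I_n -> 'I_k) : 'M[M]_(j, k) :=
  \matrix_(x, y) \big[@mmul M/eps]_(u | p u == x)
                 \big[@mmul M/eps]_(v | q v == y) A u v.

Lemma bigmmul_neq1 (I : finType) (P : pred I) (F : I -> M) i :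
  P i -> F i != eps -> \big[@mmul M/eps]_(j | P j) F j != eps.
Proof.
move=> Pi; apply: contraNneq; rewrite (bigD1 i) //= => /unitm[-> _].
exact: eqxx.
Qed.

Lemma no_eps_line_merge m n j k (A : 'M[M]_(m, n)) (p : 'I_m -> 'I_j)
    (q : 'I_n -> 'I_k) :
  surjb p -> surjb q -> no_eps_line A -> no_eps_line (merge_mx A p q).
Proof.
move=> /forallP hp /forallP hq /no_eps_lineP[hr hc].
apply/no_eps_lineP; split=> z.
- have /existsP[u pu] := hp z; have [v h] := hr u.
  exists (q v); rewrite mxE; apply: (@bigmmul_neq1 _ _ _ u) => //.
  exact: (@bigmmul_neq1 _ _ _ v).
- have /existsP[v qv] := hq z; have [u h] := hc v.
  exists (p u); rewrite mxE; apply: (@bigmmul_neq1 _ _ _ u) => //.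
  exact: (@bigmmul_neq1 _ _ _ v).
Qed.

Definition merge_diag (a b : mcomp) j k (p : qsh (nrow a) (nrow b) j)
    (q : qsh (ncol a) (ncol b) k) : mcomp :=
  mkcomp (no_eps_line_merge (andP (valP p)).2 (andP (valP q)).2
                            (comp_mxP (diag a b))).

Section Products.
Context (K : comAlgType rat).

(* The free K-module on matrix compositions; <<c>> is the basis element c. *)
Local Notation H := {malg K[mcomp]}.

Definition hdiag : H -> H -> H := bilin (fun a b => << diag a b >>).

(* Shuffle of two words in connected compositions, each word being identified
   with the block diagonal matrix of its letters. *)
Fixpoint word_shuffle (s : seq mcomp) : seq mcomp -> H :=
  fix word_shuffle_s (t : seq mcomp) : H :=
    match s, t with
    | [::], _ => << bigdiag t >>
    | _, [::] => << bigdiag s >>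
    | a :: s', b :: t' =>
        hdiag << a >> (word_shuffle s' t) + hdiag << b >> (word_shuffle_s t')
    end.

Definition block_shuffle : H -> H -> H :=
  bilin (fun a b => word_shuffle (components a) (components b)).

Definition two_shuffle : H -> H -> H := bilin (fun a b =>
  if a == cempty then << b >> else if b == cempty then << a >> else
  \sum_(p in sh (nrow a) (nrow b)) \sum_(q in sh (ncol a) (ncol b))
     << perm_diag p q >>).

(* The sums over all j, k >= 1 are finite since qsh m s j is empty for
   j > m + s. *)
Definition two_qshuffle : H -> H -> H := bilin (fun a b =>
  if a == cempty then << b >> else if b == cempty then << a >> else
  \sum_(1 <= j < (nrow a + nrow b).+1) \sum_(1 <= k < (ncol a + ncol b).+1)
     \sum_(p : qsh (nrow a) (nrow b) j) \sum_(q : qsh (ncol a) (ncol b) k)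
        << merge_diag p q >>).

(* The recursion defining the block shuffle. *)
Lemma block_shuffle0c c : block_shuffle << cempty >> << c >> = << c >>.
Proof.
rewrite /block_shuffle bilinU components_cempty.
by rewrite -[in RHS](bigdiag_components c); case: (components c).
Qed.

Lemma block_shufflec0 c : block_shuffle << c >> << cempty >> = << c >>.
Proof.
rewrite /block_shuffle bilinU components_cempty.
by rewrite -[in RHS](bigdiag_components c); case: (components c).
Qed.

Lemma block_shuffle_diag a b u v : connected a -> connected b ->
  block_shuffle << diag a u >> << diag b v >> =
    hdiag << a >> (block_shuffle << u >> << diag b v >>) +
    hdiag << b >> (block_shuffle << diag a u >> << v >>).
Proof.
by move=> ca cb; rewrite /block_shuffle !bilinU !components_diag.
Qed.

End Products.

End MatrixCompositions.

(* Isomorphism of the K-algebras (V, mul1, 1 = one1) and (W, mul2, 1 = one2). *)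
Definition alg_isomorphic (K : pzRingType) (V W : lmodType K)
    (mul1 : V -> V -> V) (one1 : V) (mul2 : W -> W -> W) (one2 : W) : Prop :=
  exists phi : {linear V -> W},
    [/\ bijective phi, phi one1 = one2 &
        forall x y, phi (mul1 x y) = mul2 (phi x) (phi y)].

(* Main.v *)
Require Import Defs.
From HB Require Import structures.
From mathcomp Require Import all_boot all_fingroup all_algebra.
From mathcomp Require Import zify finmap boolp.
From mathcomp Require Import monalg.

(** Both two-parameter products are shown to be isomorphic to the block shuffle,
    by one argument for commutative products that are compatible with
    deconcatenation.

    Regard a composition as a word in its connected components, so that the
    block shuffle is the shuffle of words. Let mul be a commutative associative
    product on H that is graded by the total degree of the entries and for which
    the deconcatenation of words is multiplicative (shuffle_like). A coalgebra
    morphism from H to words is determined by its letter part f : H -> letters,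
    and it sends mul to the shuffle as soon as f vanishes on products of
    nontrivial elements: then, in the deconcatenation of a product, only those
    terms survive whose left half comes from one factor alone, and this is the
    recursion defining the shuffle (to_block_mul). Such an f is obtained from
    the Dynkin map g, the solution of Y = id * g for the convolution product,
    where Y is the derivation that multiplies by the degree. An induction on the
    number of components shows that g vanishes on products (dynkin_mul). On a
    letter g is multiplication by the degree, so dividing by the degree, which
    is possible over the rationals, makes f the identity on letters. The
    resulting algebra morphism is then unitriangular with respect to the number
    of components, hence bijective (unitriangular_bij, shuffle_like_iso).

    That the quasi-shuffle satisfies the hypotheses is read off its structure
    constants: the coefficient of c in the quasi-shuffle of a and b is the number
    of entrywise factorizations of c into two matrices which become a and b when
    their trivial rows and columns are deleted (sum_merge,
    qshuffle_basis_count). Commutativity is the exchange of the two factors,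
    associativity compares factorizations into three matrices
    (factor_count_assoc), multiplicativity of deconcatenation holds because the
    factors of a block diagonal matrix are block diagonal (factor_count_diag),
    and the degree is additive because it is additive in the entries.

    The two-parameter shuffle is the part of the quasi-shuffle in which the
    numbers of rows and columns add up (shuffle_basis_top). These numbers are
    subadditive for the quasi-shuffle, so this part inherits all the properties
    (shuffle_like_top). *)

Set Implicit Arguments.
Unset Strict Implicit.
Unset Printing Implicit Defensive.

Import GRing.Theory.
Local Open Scope ring_scope.

(** * Linear and bilinear extension from a basis *)

Section LinearExtension.
Context (K : comNzRingType) (C : choiceType).
Local Notation F := {malg K[C]}.

Definition lin (V : lmodType K) (f : C -> V) (x : F) : V :=
  \sum_(c <- msupp x) x@_c *: f c.

(** Enlarging the range of summation lets sums over different supports be added. *)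
Lemma linEw (V : lmodType K) (f : C -> V) (D : {fset C}) x :
  (msupp x `<=` D)%fset -> lin f x = \sum_(c <- D) x@_c *: f c.
Proof.
move=> le; rewrite /lin (big_fset_incl _ le) //= => c _ /mcoeff_outdom->.
by rewrite scale0r.
Qed.

Lemma lin_is_linear (V : lmodType K) (f : C -> V) : linear (lin f).
Proof.
move=> k x y; pose D := (msupp x `|` msupp y)%fset.
rewrite (linEw f (D := D)).
  rewrite (linEw f (x := x) (D := D)) ?fsubsetUl //.
  rewrite (linEw f (x := y) (D := D)) ?fsubsetUr //.
  rewrite scaler_sumr -big_split /=; apply: eq_bigr => c _.
  by rewrite mcoeffD mcoeffZ scalerDl scalerA.
apply: (fsubset_trans (msuppD_le _ _)).
exact: fsetSU (msuppZ_le _ _).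
Qed.

HB.instance Definition _ (V : lmodType K) (f : C -> V) :=
  GRing.isLinear.Build K F V _ (lin f) (lin_is_linear f).

Lemma linU (V : lmodType K) (f : C -> V) c : lin f << c >> = f c.
Proof.
rewrite (linEw f (D := [fset c]%fset)) ?msuppU_le //.
by rewrite big_seq_fset1 mcoeffUU scale1r.
Qed.

Lemma linE (V : lmodType K) (f : {linear F -> V}) x :
  f x = lin (fun c => f << c >>) x.
Proof.
rewrite {1}[x]monalgE linear_sum; apply: eq_bigr => c _.
rewrite -linearZ; congr (f _); apply/malgP => c'.
by rewrite mcoeffZ !mcoeffU mulrnAr mulr1.
Qed.

(** Two linear maps are compared on the basis elements of one vector only; the
    shuffle recursion needs this because it holds for connected basis elements. *)
Lemma lin_ext_supp (V : lmodType K) (f g : {linear F -> V}) x :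
  (forall c, c \in msupp x -> f << c >> = g << c >>) -> f x = g x.
Proof.
move=> h; rewrite (linE f) (linE g) /lin.
by apply: eq_big_seq => c hc; rewrite h.
Qed.

Lemma lin_ext (V : lmodType K) (f g : {linear F -> V}) :
  (forall c, f << c >> = g << c >>) -> f =1 g.
Proof. by move=> h x; apply: lin_ext_supp. Qed.

Lemma eq_lin_supp (V : lmodType K) (f g : C -> V) x :
  (forall c, c \in msupp x -> f c = g c) -> lin f x = lin g x.
Proof.
by move=> H; rewrite /lin; apply: eq_big_seq => c hc; rewrite (H c hc).
Qed.

Lemma eq_lin (V : lmodType K) (f g : C -> V) : f =1 g -> lin f =1 lin g.
Proof. by move=> H x; apply: eq_lin_supp. Qed.

Lemma lin_id (x : F) : lin (fun c => << c >>) x = x.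
Proof.
rewrite [RHS]monalgE; apply: eq_bigr => c _; apply/malgP => c'.
by rewrite mcoeffZ !mcoeffU mulrnAr mulr1.
Qed.

Lemma lin_comp (V W : lmodType K) (f : {linear V -> W}) (g : C -> V) x :
  f (lin g x) = lin (fun c => f (g c)) x.
Proof. by rewrite linear_sum; apply: eq_bigr => c _; rewrite linearZ. Qed.

Lemma lin_scale (V : lmodType K) (k : K) (f : C -> V) x :
  lin (fun c => k *: f c) x = k *: lin f x.
Proof.
rewrite scaler_sumr; apply: eq_bigr => c _.
by rewrite !scalerA mulrC.
Qed.

Lemma mcoeff_lin (D : choiceType) (f : C -> {malg K[D]}) x k :
  (lin f x)@_k = \sum_(c <- msupp x) x@_c * (f c)@_k.
Proof. by rewrite raddf_sum; apply: eq_bigr => c _; rewrite /= mcoeffZ. Qed.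

Variable V : lmodType K.
Implicit Type f : C -> C -> V.

Lemma bilin_lin f x y : bilin f x y = lin (fun a => lin (f a) y) x.
Proof.
apply: eq_bigr => a _; rewrite scaler_sumr; apply: eq_bigr => b _.
by rewrite scalerA.
Qed.

Lemma bilin_linr f x y : bilin f x y = lin (fun b => lin (f^~ b) x) y.
Proof.
rewrite /bilin exchange_big /=; apply: eq_bigr => b _.
rewrite scaler_sumr; apply: eq_bigr => a _.
by rewrite scalerA mulrC.
Qed.

Lemma bilinUl f a y : bilin f << a >> y = lin (f a) y.
Proof. by rewrite bilin_lin linU. Qed.

Lemma bilinUr f x b : bilin f x << b >> = lin (f^~ b) x.
Proof. by rewrite bilin_linr linU. Qed.

Lemma bilin_linear f x : linear (bilin f x).
Proof. by move=> k y z; rewrite !bilin_linr linearP. Qed.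

Lemma bilin_linearl f y : linear (fun x => bilin f x y).
Proof. by move=> k x z; rewrite !bilin_lin linearP. Qed.

HB.instance Definition _ f x := GRing.isLinear.Build K F V _ (bilin f x)
  (bilin_linear f x).

(** A name for partial application in the second argument, so that it can carry
    its linear structure. *)
Definition bilinl f y x := bilin f x y.
HB.instance Definition _ f y := GRing.isLinear.Build K F V _ (bilinl f y)
  (bilin_linearl f y).

Lemma bilin_suml f I (r : seq I) (P : pred I) (x : I -> F) y :
  bilin f (\sum_(i <- r | P i) x i) y = \sum_(i <- r | P i) bilin f (x i) y.
Proof. exact: (linear_sum (bilinl f y)). Qed.

Lemma bilin_sumr f I (r : seq I) (P : pred I) x (y : I -> F) :
  bilin f x (\sum_(i <- r | P i) y i) = \sum_(i <- r | P i) bilin f x (y i).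
Proof. exact: (linear_sum (bilin f x)). Qed.

Lemma bilin0l f y : bilin f 0 y = 0.
Proof. exact: (linear0 (bilinl f y)). Qed.

End LinearExtension.

(** * Diagonal splittings of a composition *)

Section Splittings.
Context (d : nat).
Local Notation C := (mcomp d).
Local Notation e := (cempty d).
Implicit Types (a b c l u : C).

Lemma bigdiag_ind (P : C -> Prop) :
  P e -> (forall l u, connected l -> P u -> P (diag l u)) -> forall c, P c.
Proof.
move=> P0 PS c; rewrite -(bigdiag_components c).
have: forall l, l \in components c -> connected l.
  by move=> l; exact: components_connected.
elim: (components c) => [//|l s IHs] H; apply: PS => [|/=].
  by apply: H; rewrite mem_head.
by apply: IHs => x hx; apply: H; rewrite inE hx orbT.
Qed.

Definition len c := size (components c).

Lemma len0 : len e = 0%N.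
Proof. by rewrite /len components_cempty. Qed.

Lemma len_diagl l u : connected l -> len (diag l u) = (len u).+1.
Proof. by move=> h; rewrite /len components_diag. Qed.

Lemma len_diag a b : len (diag a b) = (len a + len b)%N.
Proof.
elim/bigdiag_ind: a => [|l u hl IH]; first by rewrite diag0c len0.
by rewrite -diagA !(len_diagl _ hl) IH.
Qed.

Lemma len_eq0 c : (len c == 0%N) = (c == e).
Proof.
apply/eqP/eqP => [|->]; last exact: len0.
by elim/bigdiag_ind: c => // l u hl _; rewrite len_diagl.
Qed.

Lemma len_gt0 c : c != e -> (0 < len c)%N.
Proof. by rewrite lt0n len_eq0. Qed.

Lemma diag_eq0 a b : (diag a b == e) = (a == e) && (b == e).
Proof. by rewrite -!len_eq0 len_diag addn_eq0. Qed.

Fixpoint word_splits (s : seq C) : seq (C * C) :=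
  (e, bigdiag s) ::
  if s is l :: s' then [seq (diag l p.1, p.2) | p <- word_splits s'] else [::].

Definition splits c := word_splits (components c).

Lemma splits0 : splits e = [:: (e, e)].
Proof. by rewrite /splits components_cempty. Qed.

Lemma splits_diagl l u : connected l ->
  splits (diag l u) =
    (e, diag l u) :: [seq (diag l p.1, p.2) | p <- splits u].
Proof. by move=> h; rewrite /splits components_diag //= bigdiag_components. Qed.

(** Splittings of the word of components are all the factorizations for diag,
    since the decomposition into connected components is unique. *)
Lemma mem_splits a b c : ((a, b) \in splits c) = (diag a b == c).
Proof.
apply/idP/eqP => [|<-].
  elim/bigdiag_ind: c a b => [|l u hl IH] a b.
    by rewrite splits0 inE => /eqP[-> ->]; rewrite diag0c.
  rewrite splits_diagl // inE => /orP[/eqP[-> ->]|]; first exact: diag0c.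
  by case/mapP=> -[x y] /IH <- /= [-> ->]; rewrite diagA.
elim/bigdiag_ind: a => [|l u hl IH].
  rewrite diag0c; elim/bigdiag_ind: b => [|l u hl _].
    by rewrite splits0 inE.
  by rewrite splits_diagl // mem_head.
rewrite -diagA splits_diagl // inE; apply/orP; right.
by apply/mapP; exists (u, b).
Qed.

Lemma diag_connected_injr l : connected l -> injective (diag l).
Proof. by move=> hl u v /(connected_diag_inj hl hl)[]. Qed.

Lemma connected_neq0 l : connected l -> l != e.
Proof. by case=> /eqP. Qed.

Lemma uniq_splits c : uniq (splits c).
Proof.
elim/bigdiag_ind: c => [|l u hl IH]; first by rewrite splits0.
rewrite splits_diagl //= map_inj_uniq ?IH ?andbT.
  apply/negP => /mapP[[x y] _ /(congr1 fst)/esym/eqP].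
  by rewrite diag_eq0 (negPf (connected_neq0 hl)).
move=> [x y] [x' y'] /= E; move: (congr1 snd E) (congr1 fst E) => /= ->.
by move/(diag_connected_injr hl) => ->.
Qed.

Lemma splits_len c p : p \in splits c -> len c = (len p.1 + len p.2)%N.
Proof. by case: p => a b; rewrite mem_splits => /eqP<-; rewrite len_diag. Qed.

Lemma split_c0 c : (c, e) \in splits c.
Proof. by rewrite mem_splits diagc0. Qed.

Lemma split_0c c : (e, c) \in splits c.
Proof. by rewrite mem_splits diag0c. Qed.

Lemma splits0_l c p : p \in splits c -> p.1 = e -> p.2 = c.
Proof. by case: p => a b; rewrite mem_splits /= => /eqP<- ->; rewrite diag0c. Qed.

Lemma splits0_r c p : p \in splits c -> p.2 = e -> p.1 = c.
Proof. by case: p => a b; rewrite mem_splits /= => /eqP<- ->; rewrite diagc0. Qed.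

Lemma sum_splits_l (V : nmodType) c (x : V) :
  \sum_(p <- splits c) (if p.1 == e then x else 0) = x.
Proof.
rewrite (bigD1_seq (e, c)) ?uniq_splits ?split_0c //= eqxx big1_seq ?addr0 //.
move=> p /andP[pne hp]; case: eqP => // p1; move: pne.
by rewrite -(splits0_l hp p1) -p1 -surjective_pairing eqxx.
Qed.

Lemma sum_splits_r (V : nmodType) c (x : V) :
  \sum_(p <- splits c) (if p.2 == e then x else 0) = x.
Proof.
rewrite (bigD1_seq (c, e)) ?uniq_splits ?split_c0 //= eqxx big1_seq ?addr0 //.
move=> p /andP[pne hp]; case: eqP => // p2; move: pne.
by rewrite -(splits0_r hp p2) -p2 -surjective_pairing eqxx.
Qed.

Lemma splits_bigl (V : nmodType) c (F : C * C -> V) :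
  \sum_(p <- splits c) F p =
  F (e, c) + \sum_(p <- splits c | p.1 != e) F p.
Proof.
rewrite (bigID (fun p => p.1 == e)) /=; congr (_ + _).
rewrite -[RHS](sum_splits_l c) big_mkcond /=.
apply: eq_big_seq => p hp; case: eqP => // p1.
by rewrite -(splits0_l hp p1) -p1 -surjective_pairing.
Qed.

(** Well-founded recursion along the number of components, obtained by iterating
    the defining equation often enough for the value to be stable. *)
Lemma len_rec (X : Type) (x0 : X) (Phi : (C -> X) -> C -> X) :
  (forall h h' c, (forall c', (len c' < len c)%N -> h c' = h' c') ->
     Phi h c = Phi h' c) ->
  {h : C -> X | forall c, h c = Phi h c}.
Proof.
move=> hPhi; pose it n := iter n Phi (fun=> x0).
have stab n c : (len c < n)%N -> forall m, (len c < m)%N -> it n c = it m c.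
  elim: n c => // n IH c hn [//|m] hm; apply: hPhi => c' hc'.
  by apply: IH; apply: leq_trans hc' _.
exists (fun c => it (len c).+1 c) => c; apply: hPhi => c' hc'.
exact: stab.
Qed.

End Splittings.

(** * Unitriangular maps *)

Section Triangular.
Context (d : nat) (K : comNzRingType).
Local Notation C := (mcomp d).
Local Notation H := {malg K[C]}.

Definition below n (x : H) := forall c, c \in msupp x -> (len c < n)%N.

Lemma below0 n : below n 0.
Proof. by move=> c; rewrite msupp0. Qed.

Lemma belowD n x y : below n x -> below n y -> below n (x + y).
Proof.
move=> hx hy c /(fsubsetP (msuppD_le _ _)).
by rewrite in_fsetU => /orP[/hx|/hy].
Qed.

Lemma belowZ n k x : below n x -> below n (k *: x).
Proof. by move=> hx c /(fsubsetP (msuppZ_le _ _))/hx. Qed.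

Lemma below_sum n I (r : seq I) (P : pred I) (x : I -> H) :
  (forall i, P i -> below n (x i)) -> below n (\sum_(i <- r | P i) x i).
Proof.
by move=> h; elim/big_rec: _ => [|i y Pi hy]; [exact: below0|apply: belowD; auto].
Qed.

Lemma belowU n c : (len c < n)%N -> below n << c >>.
Proof. by move=> h c' /(fsubsetP msuppU_le); rewrite in_fset1 => /eqP->. Qed.

Lemma below_le n m x : (n <= m)%N -> below n x -> below m x.
Proof. by move=> h hx c /hx hc; apply: leq_trans h. Qed.

Lemma below_bigmax x : exists n, below n x.
Proof.
exists (\max_(c <- msupp x) len c).+1 => c hc; rewrite ltnS.
by rewrite (big_rem c hc) /= leq_maxl.
Qed.

Lemma below_lin n (phi : C -> H) x :
  (forall c, c \in msupp x -> below n (phi c)) -> below n (lin phi x).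
Proof.
move=> h; rewrite /lin big_seq; apply: below_sum => c hc.
exact/belowZ/h.
Qed.

(** The difference D of the map and the identity lowers the number of components.
    A kernel element x equals - D x, so its support shrinks forever; a preimage of
    y is y corrected by a preimage of D y, which lies lower. *)
Lemma unitriangular_bij (phi : C -> H) :
  (forall c, below (len c) (phi c - << c >>)) -> bijective (lin phi).
Proof.
move=> hphi.
have hD n x : below n.+1 x -> below n (lin phi x - x).
  move=> hx; have -> : lin phi x - x = lin (fun c => phi c - << c >>) x.
    rewrite -{2}[x]lin_id -sumrB; apply: eq_bigr => c _.
    by rewrite scalerBr.
  by apply: below_lin => c /hx hc; apply: below_le (hphi c).
have z x : below 0 x -> x = 0.
  move=> h; apply/malgP => c; rewrite mcoeff0 mcoeff_outdom //.
  by apply/negP => /h.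
(* The support of a kernel element lies below every bound. *)
have inj : injective (lin phi).
  apply: raddf_inj => x; have [n] := below_bigmax x.
  elim: n => [|n IH] hx hphi0; first exact: z.
  apply: IH => //; have := hD _ _ hx; rewrite hphi0 sub0r => h c hc.
  by apply: h; rewrite msuppN.
have surj y : exists x, lin phi x == y.
  have [n] := below_bigmax y; elim: n y => [|n IH] y hy.
    by exists 0; rewrite linear0 (z y).
  have [x /eqP hx] := IH _ (hD _ _ hy).
  by exists (y - x); rewrite linearB /= hx opprB addrC subrK.
exists (fun y => xchoose (surj y)) => [x|y]; last exact/eqP/(xchooseP (surj y)).
exact/inj/eqP/(xchooseP (surj _)).
Qed.

End Triangular.

(** * Deconcatenation along the diagonal *)

Section Coproduct.
Context (d : nat) (K : comNzRingType).
Local Notation C := (mcomp d).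
Local Notation H := {malg K[C]}.

Definition deconc (x : H) : {malg K[(C * C)%type]} :=
  lin (fun c => \sum_(p <- splits c) << p >>) x.

Definition tensor : H -> H -> {malg K[(C * C)%type]} := bilin (fun a b => << (a, b) >>).

Lemma sum_eq_mem (T : eqType) (s : seq T) k :
  uniq s -> \sum_(p <- s) (k == p)%:R = (k \in s)%:R :> K.
Proof.
move=> us; under eq_bigr do rewrite mulrb.
rewrite -big_mkcond /= big_const_seq iter_addr_0 -(count_uniq_mem _ us).
by congr (_ *+ _); apply: eq_count => x; rewrite /= eq_sym.
Qed.

Lemma mcoeff_sumU (D : choiceType) (s : seq D) k :
  uniq s -> (\sum_(p <- s) << p >> : {malg K[D]})@_k = (k \in s)%:R.
Proof.
move=> us; rewrite raddf_sum -sum_eq_mem //=.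
by apply: eq_bigr => p _; rewrite mcoeffU eq_sym.
Qed.

(** The coproduct is dual to diag on the basis, because each splitting of c occurs
    exactly once. *)
Lemma mcoeff_deconc x a b : (deconc x)@_(a, b) = x@_(diag a b).
Proof.
rewrite mcoeff_lin -[in RHS](lin_id x) mcoeff_lin.
apply: eq_bigr => c _; rewrite mcoeff_sumU ?uniq_splits // mem_splits.
by rewrite mcoeffU eq_sym.
Qed.

Lemma mcoeff_tensor x y a b : (tensor x y)@_(a, b) = x@_a * y@_b.
Proof.
rewrite /tensor bilin_lin mcoeff_lin -[in RHS](lin_id x) mcoeff_lin mulr_suml.
apply: eq_bigr => c _; rewrite -mulrA; congr (_ * _).
rewrite mcoeff_lin -[in RHS](lin_id y) mcoeff_lin mulr_sumr.
apply: eq_bigr => c' _; rewrite mulrCA; congr (_ * _).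
rewrite !mcoeffU xpair_eqE.
by case: eqP; case: eqP; rewrite ?mulr1 ?mulr0 ?mul0r.
Qed.

Lemma lin_deconc (V : lmodType K) (F : C -> C -> V) x :
  lin (fun p => F p.1 p.2) (deconc x) =
  lin (fun c => \sum_(p <- splits c) F p.1 p.2) x.
Proof.
rewrite /deconc lin_comp; apply: eq_lin => c.
by rewrite linear_sum; apply: eq_bigr => p _; rewrite /= linU.
Qed.

Lemma lin_tensor (V : lmodType K) (F : C -> C -> V) x y :
  lin (fun p => F p.1 p.2) (tensor x y) = bilin F x y.
Proof.
rewrite /tensor !bilin_lin lin_comp; apply: eq_lin => a.
by rewrite lin_comp; apply: eq_lin => b; rewrite /= linU.
Qed.

End Coproduct.

(** * Commutative algebras compatible with deconcatenation *)

Section ShuffleLike.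
Context (d : nat) (K : comNzRingType).
Local Notation C := (mcomp d).
Local Notation H := {malg K[C]}.
Local Notation e := (cempty d).

(** What the argument uses about a product given on the basis by mu: it makes the
    span of the compositions a commutative unital algebra, deconcatenation is
    multiplicative for it, and deg is a grading. Multiplicativity of
    deconcatenation (mu_deconc) is stated on coefficients, the coefficient of
    c1 tensor c2 in the coproduct of x being the coefficient of diag c1 c2 in x. *)
Record shuffle_like (deg : C -> nat) (mu : C -> C -> H) : Prop := ShuffleLike {
  mu_unit : forall c, mu e c = << c >>;
  mu_comm : forall a b, mu a b = mu b a;
  mu_assoc : forall a b c, bilin mu (mu a b) << c >> = bilin mu << a >> (mu b c);
  mu_deconc : forall a b c1 c2, (mu a b)@_(diag c1 c2) =
    \sum_(p <- splits a) \sum_(q <- splits b)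
      (mu p.1 q.1)@_c1 * (mu p.2 q.2)@_c2;
  mu_graded : forall a b c, c \in msupp (mu a b) -> deg c = (deg a + deg b)%N
}.

Section Theory.
Variables (deg : C -> nat) (mu : C -> C -> H).
Hypothesis hmu : shuffle_like deg mu.
Hypothesis deg_eq0 : forall c, (deg c == 0%N) = (c == e).
Local Notation mul := (bilin mu).

Lemma mul_unitl x : mul << e >> x = x.
Proof.
by rewrite bilinUl (eq_lin (g := fun c => << c >>)) ?lin_id; last exact: mu_unit hmu.
Qed.

Lemma mul_comm x y : mul x y = mul y x.
Proof.
rewrite bilin_linr bilin_lin; apply: eq_lin => a; apply: eq_lin => b.
exact: mu_comm hmu _ _.
Qed.

Lemma mul_assoc x y z : mul (mul x y) z = mul x (mul y z).
Proof.
apply: (lin_ext (f := bilinl mu z \o bilinl mu y)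
                (g := bilinl mu (mul y z))) => a /=; rewrite /bilinl {x}.
apply: (lin_ext (f := bilinl mu z \o mul << a >>)
                (g := mul << a >> \o bilinl mu z)) => b /=; rewrite /bilinl {y}.
apply: (lin_ext (f := mul (mul << a >> << b >>))
                (g := mul << a >> \o mul << b >>)) => c /=.
by rewrite !bilinU; exact: mu_assoc hmu _ _ _.
Qed.

(** The usable form of the multiplicativity of deconcatenation: any bilinear
    expression in the two halves of a product is a sum over the splittings of the
    factors. *)
Lemma deconc_mu (V : lmodType K) (F : C -> C -> V) a b :
  lin (fun c => \sum_(p <- splits c) F p.1 p.2) (mu a b) =
  \sum_(p <- splits a) \sum_(q <- splits b)
    bilin F (mu p.1 q.1) (mu p.2 q.2).
Proof.
rewrite -lin_deconc.
have -> : deconc (mu a b) = \sum_(p <- splits a) \sum_(q <- splits b)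
    tensor (mu p.1 q.1) (mu p.2 q.2).
  apply/malgP => -[c1 c2]; rewrite mcoeff_deconc (mu_deconc hmu) raddf_sum.
  apply: eq_bigr => p _; rewrite raddf_sum; apply: eq_bigr => q _.
  by rewrite /= mcoeff_tensor.
rewrite linear_sum; apply: eq_bigr => p _.
by rewrite linear_sum; apply: eq_bigr => q _; rewrite /= lin_tensor.
Qed.

End Theory.
End ShuffleLike.

(** * The block shuffle on arbitrary elements *)

Section BlockShuffle.
Context (d : nat) (K : comNzRingType).
Local Notation C := (mcomp d).
Local Notation H := {malg K[C]}.
Local Notation e := (cempty d).

Definition ldiag : H -> H -> H := bilin (fun a b => << diag a b >>).

Variable B : C -> C -> H.

(** The interface to the block shuffle over an arbitrary commutative ring, where the
    argument takes place: rational scalars only enter through inverses of integers. *)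
Record block_shuffle_like : Prop := BlockShuffleLike {
  bs_unitl : forall c, B e c = << c >>;
  bs_unitr : forall c, B c e = << c >>;
  bs_rec : forall a b u v, connected a -> connected b ->
    B (diag a u) (diag b v) =
      ldiag << a >> (B u (diag b v)) + ldiag << b >> (B (diag a u) v)
}.

Hypothesis hB : block_shuffle_like.
Local Notation bs := (bilin B).
Local Notation hd := ldiag.

Lemma block_shuffle0l x : bs << e >> x = x.
Proof.
rewrite bilinUl -[RHS]lin_id; apply: eq_lin => c; exact: bs_unitl hB _.
Qed.

Lemma block_shuffle0r x : bs x << e >> = x.
Proof.
rewrite bilinUr -[RHS]lin_id; apply: eq_lin => c; exact: bs_unitr hB _.
Qed.

(** Elements of the span of the connected compositions, the space of letters. *)
Definition letters (x : H) := forall c, c \in msupp x -> connected c.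

(** Each of the four arguments enters linearly, so the recursion on the basis
    extends. *)
Lemma block_shuffle_letters l l' u v : letters l -> letters l' ->
  bs (hd l u) (hd l' v) = hd l (bs u (hd l' v)) + hd l' (bs (hd l u) v).
Proof.
move=> hl hl'; rewrite /ldiag.
set D : C -> C -> H := fun a b => << _ >>.
apply: (lin_ext_supp (f := bilinl B (bilin D l' v) \o bilinl D u)
  (g := bilinl D (bilin B u (bilin D l' v)) \+
        (bilin D l' \o bilinl B v \o bilinl D u))) => a /hl ha /=.
rewrite /bilinl.
apply: (lin_ext_supp (f := bilin B (bilin D << a >> u) \o bilinl D v)
  (g := (bilin D << a >> \o bilin B u \o bilinl D v) \+
        (bilinl D (bilin B (bilin D << a >> u) v)))) => b /hl' hb /=.
rewrite /bilinl.
apply: (lin_ext (f := bilinl B (bilin D << b >> v) \o bilin D << a >>)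
  (g := (bilin D << a >> \o bilinl B (bilin D << b >> v)) \+
        (bilin D << b >> \o bilinl B v \o bilin D << a >>))) => x /=.
rewrite /bilinl.
apply: (lin_ext (f := bilin B (bilin D << a >> << x >>) \o bilin D << b >>)
  (g := (bilin D << a >> \o bilin B << x >> \o bilin D << b >>) \+
        (bilin D << b >> \o bilin B (bilin D << a >> << x >>)))) => y /=.
rewrite !bilinU; exact: bs_rec hB _ _ _ _ ha hb.
Qed.

End BlockShuffle.

(** * The isomorphism onto the block shuffle algebra *)

Section Isomorphism.
Context (d : nat) (K : comNzRingType).
Variable inv : nat -> K.
Hypothesis invK : forall n, n != 0%N -> inv n * n%:R = 1.
Local Notation C := (mcomp d).
Local Notation H := {malg K[C]}.
Local Notation e := (cempty d).

Variables (deg : C -> nat) (mu : C -> C -> H).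
Hypothesis hmu : shuffle_like deg mu.
Hypothesis deg_eq0 : forall c, (deg c == 0%N) = (c == e).
Local Notation mul := (bilin mu).

Lemma bilin_lin_right (V : lmodType K) (m : C -> C -> V)
  (F : C -> H) (G : C -> H) x y :
  bilin (fun a b => bilin m (F a) (G b)) x y = bilin m (lin F x) (lin G y).
Proof.
rewrite bilin_lin -[RHS]/(bilinl m (lin G y) (lin F x)) lin_comp.
by apply: eq_lin => a; rewrite /bilinl -lin_comp.
Qed.

(** The defining recursion of the Dynkin map g. In convolution notation it says
    Y = id * g, where Y multiplies a basis element by its degree; the summand with
    trivial left half is g c itself, which makes this a recursion. *)
Lemma dynkin_rec : {g : C -> H | forall c,
  (deg c)%:R *: << c >> = \sum_(p <- splits c) mul << p.1 >> (g p.2)}.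
Proof.
have [h h' c hh'|g hg] := @len_rec d H 0 (fun h c => (deg c)%:R *: << c >> -
    \sum_(p <- splits c | p.1 != e) mul << p.1 >> (h p.2)).
  congr (_ - _); rewrite big_seq_cond [RHS]big_seq_cond.
  apply: eq_bigr => p /andP[hp p1]; rewrite hh' // (splits_len hp).
  by rewrite -[X in (X < _)%N]add0n ltn_add2r len_gt0.
by exists g => c; rewrite splits_bigl /= (mul_unitl hmu) {1}hg subrK.
Qed.

Definition dynkin : C -> H := sval dynkin_rec.

Lemma dynkinE c :
  (deg c)%:R *: << c >> = \sum_(p <- splits c) mul << p.1 >> (dynkin p.2).
Proof. exact: (svalP dynkin_rec). Qed.

Lemma dynkin0 : dynkin e = 0.
Proof.
have := dynkinE e; rewrite splits0 big_seq1 /= (mul_unitl hmu) => <-.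
by rewrite (eqP (etrans (deg_eq0 e) (eqxx e))) scale0r.
Qed.

(** Y is a derivation and id is multiplicative, so evaluating Y = id * g on a
    product a b and removing all the summands known by induction leaves
    deg a (a b) + deg b (a b) = g (a b) + deg a (a b) + deg b (a b). *)
Lemma dynkin_mul a b : a != e -> b != e -> lin dynkin (mu a b) = 0.
Proof.
have [n] := ubnP (len a + len b); elim: n a b => // n IH a b hn a0 b0.
have: lin (fun c => \sum_(p <- splits c) mul << p.1 >> (dynkin p.2)) (mu a b) =
    (deg a + deg b)%:R *: mu a b.
  rewrite -[in RHS](lin_id (mu a b)) -lin_scale; apply: eq_lin_supp => c hc.
  by rewrite -dynkinE (mu_graded hmu hc).
rewrite (deconc_mu hmu (fun c1 c2 => mul << c1 >> (dynkin c2))).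
set X := lin dynkin (mu a b).
(* By induction dynkin vanishes on the product of the right halves unless one of
   them is trivial, or both left halves are, which leaves the term X. *)
have -> : \sum_(p <- splits a) \sum_(q <- splits b)
    bilin (fun c1 c2 => mul << c1 >> (dynkin c2)) (mu p.1 q.1) (mu p.2 q.2) =
  \sum_(p <- splits a) \sum_(q <- splits b)
    ((if p.2 == e then mul << a >> (mul << q.1 >> (dynkin q.2)) else 0) +
     (if q.2 == e then mul << b >> (mul << p.1 >> (dynkin p.2)) else 0) +
     (if p.1 == e then if q.1 == e then X else 0 else 0)).
  apply: eq_big_seq => -[a1 a2] hp; apply: eq_big_seq => -[b1 b2] hq /=.
  rewrite bilin_lin_right lin_id.
  have [a2e|a2n] := eqVneq a2 e.
    have a1a : a1 = a := splits0_r hp a2e.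
    rewrite a2e a1a (negPf a0) addr0 dynkin0 !linear0 if_same addr0.
    by rewrite (mu_unit hmu) linU -(mul_assoc hmu) bilinU.
  rewrite add0r; have [b2e|b2n] := eqVneq b2 e.
    have b1b : b1 = b := splits0_r hq b2e.
    rewrite b2e b1b (negPf b0) if_same addr0 (mu_comm hmu a2) (mu_unit hmu) linU.
    by rewrite -(mul_assoc hmu) bilinU (mu_comm hmu b).
  rewrite add0r; have [a1e|a1n] := eqVneq a1 e; have [b1e|b1n] := eqVneq b1 e.
  - have a2a : a2 = a := splits0_l hp a1e.
    have b2b : b2 = b := splits0_l hq b1e.
    by rewrite /X a2a b2b a1e b1e (mu_unit hmu) (mul_unitl hmu).
  - rewrite IH ?linear0 //; move: hn; rewrite (splits_len hp) (splits_len hq) /=.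
    by have := len_gt0 b1n; lia.
  - rewrite IH ?linear0 //; move: hn; rewrite (splits_len hp) (splits_len hq) /=.
    by have := len_gt0 a1n; lia.
  - rewrite IH ?linear0 //; move: hn; rewrite (splits_len hp) (splits_len hq) /=.
    by have := len_gt0 a1n; lia.
under eq_bigr do rewrite !big_split /=.
rewrite !big_split /= exchange_big /=.
under eq_bigr do rewrite sum_splits_r.
rewrite -linear_sum -dynkinE linearZ /= bilinU.
under [X in _ + X + _]eq_bigr do rewrite sum_splits_r.
rewrite -linear_sum -dynkinE linearZ /= bilinU (mu_comm hmu b).
under eq_bigr => p _.
  rewrite (_ : \sum_(q <- _) _ = if p.1 == e then X else 0); last first.
    by case: ifP => _; rewrite ?sum_splits_l ?big1.
  over.
rewrite sum_splits_l natrD scalerDl [(deg b)%:R *: _ + _]addrC.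
by move/(canRL (addKr _)); rewrite addNr.
Qed.

Definition proj_letters : H -> H :=
  lin (fun c => if `[< connected c >] then << c >> else 0).

Lemma proj_letters_letters x : letters (proj_letters x).
Proof.
move=> c; rewrite -mcoeff_neq0 mcoeff_lin; case: (asboolP (connected c)) => //.
move=> hc; rewrite big1 ?eqxx // => c' _.
case: asboolP => hc'; last by rewrite mcoeff0 mulr0.
by rewrite mcoeffU; case: eqP => [E|]; [rewrite E in hc'|rewrite mulr0].
Qed.

(** The projection of the Dynkin map to the letters, normalised to be the identity
    on letters. Dividing by the degree is the place where rational scalars are
    needed. *)
Definition letter_part c : H := inv (deg c) *: proj_letters (dynkin c).

Lemma letter_part_letters c : letters (letter_part c).
Proof. by move=> c' /(fsubsetP (msuppZ_le _ _)); exact: proj_letters_letters. Qed.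

Lemma letter_part0 : letter_part e = 0.
Proof. by rewrite /letter_part dynkin0 /proj_letters linear0 scaler0. Qed.

Lemma splits_letter l : connected l -> splits l = [:: (e, l); (l, e)].
Proof.
by move=> h; rewrite -{1}(diagc0 l) splits_diagl // splits0 /= diagc0.
Qed.

Lemma letter_part_letter l : connected l -> letter_part l = << l >>.
Proof.
move=> hl; have := dynkinE l.
(* A letter has only the two trivial splittings. *)
rewrite splits_letter // big_cons big_seq1 /= (mul_unitl hmu) dynkin0 linear0 addr0.
rewrite /letter_part => <-; rewrite /proj_letters linearZ /= linU asboolT //.
by rewrite scalerA invK ?scale1r // deg_eq0 connected_neq0.
Qed.

(** A product is homogeneous, so the normalisation is one common scalar. *)
Lemma letter_part_mul a b : a != e -> b != e -> lin letter_part (mu a b) = 0.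
Proof.
move=> a0 b0; transitivity (inv (deg a + deg b) *: proj_letters (lin dynkin (mu a b))).
  rewrite [proj_letters _]lin_comp -lin_scale; apply: eq_lin_supp => c hc.
  by rewrite /letter_part (mu_graded hmu hc).
by rewrite dynkin_mul // /proj_letters linear0 scaler0.
Qed.

Variable B : C -> C -> H.
Hypothesis hB : block_shuffle_like B.
Local Notation bs := (bilin B).
Local Notation hd := (@ldiag d K).

(** The coalgebra morphism induced by letter_part: the sum, over all the ways to
    split c into nonempty blocks, of the block diagonal word of the letter parts
    of the blocks. *)
Definition to_block_rec : {phi : C -> H | forall c, phi c =
  if c == e then << e >> else
  \sum_(p <- splits c | p.1 != e) hd (letter_part p.1) (phi p.2)}.
Proof.
apply: (@len_rec d H 0) => h h' c hh'; case: ifP => // _.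
rewrite big_seq_cond [RHS]big_seq_cond.
apply: eq_bigr => p /andP[hp p1]; rewrite hh' // (splits_len hp).
by rewrite -[X in (X < _)%N]add0n ltn_add2r len_gt0.
Qed.

Definition to_block : C -> H := sval to_block_rec.

Lemma to_block0 : to_block e = << e >>.
Proof. by rewrite /to_block (svalP to_block_rec) eqxx. Qed.

Lemma to_blockE c : to_block c = (if c == e then << e >> else 0) +
  \sum_(p <- splits c) hd (letter_part p.1) (to_block p.2).
Proof.
rewrite {1}/to_block (svalP to_block_rec) splits_bigl /= letter_part0 /ldiag bilin0l add0r.
case: eqP => [->|_]; last by rewrite add0r.
rewrite splits0 big_cons big_nil /= eqxx /= addr0.
by [].
Qed.

Lemma to_blockE_neq0 c : c != e ->
  to_block c = \sum_(p <- splits c) hd (letter_part p.1) (to_block p.2).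
Proof. by move=> c0; rewrite to_blockE (negPf c0) add0r. Qed.

(** Letter parts vanish on products, so when the product of a and b is split,
    only the terms survive whose left half comes from a alone or from b alone.
    These are the two terms of the shuffle recursion. *)
Lemma to_block_mul a b : lin to_block (mu a b) = bs (to_block a) (to_block b).
Proof.
have [n] := ubnP (len a + len b); elim: n a b => // n IH a b hn.
have [->|a0] := eqVneq a e.
  by rewrite (mu_unit hmu) linU to_block0 (block_shuffle0l hB).
have [->|b0] := eqVneq b e.
  by rewrite (mu_comm hmu) (mu_unit hmu) linU to_block0 (block_shuffle0r hB).
transitivity (lin (fun c => \sum_(p <- splits c) hd (letter_part p.1) (to_block p.2))
                  (mu a b)).
  apply: eq_lin_supp => c /(mu_graded hmu) hc; rewrite to_blockE_neq0 //.
  by rewrite -deg_eq0 hc addn_eq0 !deg_eq0 (negPf a0).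
rewrite (deconc_mu hmu (fun c1 c2 => hd (letter_part c1) (to_block c2))).
(* The indicators select the splittings in which one left half is trivial; when
   both are, the two sides vanish because letter_part kills the empty composition. *)
transitivity (\sum_(p <- splits a) \sum_(q <- splits b)
    ((if q.1 == e then hd (letter_part p.1) (bs (to_block p.2) (to_block b)) else 0) +
     (if p.1 == e then hd (letter_part q.1) (bs (to_block a) (to_block q.2)) else 0))).
  apply: eq_big_seq => -[a1 a2] hp; apply: eq_big_seq => -[b1 b2] hq /=.
  rewrite /ldiag bilin_lin_right.
  have [b1e|b1n] := eqVneq b1 e.
    rewrite b1e (mu_comm hmu) (mu_unit hmu) linU letter_part0 bilin0l if_same.
    have -> : b2 = b := splits0_l hq b1e; rewrite addr0.
    have [->|a1n] := eqVneq a1 e; first by rewrite letter_part0 !bilin0l.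
    rewrite IH //; move: hn; rewrite (splits_len hp) /=.
    by have := len_gt0 a1n; lia.
  rewrite add0r; have [a1e|a1n] := eqVneq a1 e; last first.
    by rewrite letter_part_mul // bilin0l.
  have -> : a2 = a := splits0_l hp a1e; rewrite a1e (mu_unit hmu) linU.
  rewrite IH //; move: hn; rewrite (splits_len hq) /=.
  by have := len_gt0 b1n; lia.
transitivity (\sum_(p <- splits a) hd (letter_part p.1) (bs (to_block p.2) (to_block b)) +
              \sum_(q <- splits b) hd (letter_part q.1) (bs (to_block a) (to_block q.2))).
  under eq_bigr do rewrite big_split /= sum_splits_l.
  rewrite big_split /=; congr (_ + _); rewrite exchange_big /=.
  by apply: eq_bigr => q _; rewrite sum_splits_l.
transitivity (\sum_(p <- splits a) \sum_(q <- splits b)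
    (hd (letter_part p.1) (bs (to_block p.2) (hd (letter_part q.1) (to_block q.2))) +
     hd (letter_part q.1) (bs (hd (letter_part p.1) (to_block p.2)) (to_block q.2)))).
  under [RHS]eq_bigr do rewrite big_split.
  rewrite big_split /=; congr (_ + _).
    apply: eq_bigr => p _; rewrite (to_blockE_neq0 b0).
    by rewrite (bilin_sumr B) [LHS]bilin_sumr.
  rewrite exchange_big /=; apply: eq_bigr => q _.
  by rewrite (to_blockE_neq0 a0) (bilin_suml B) [LHS]bilin_sumr.
rewrite (to_blockE_neq0 a0) (to_blockE_neq0 b0) (bilin_suml B).
apply: eq_bigr => p _; rewrite (bilin_sumr B); apply: eq_bigr => q _.
by rewrite -(block_shuffle_letters hB) //; exact: letter_part_letters.
Qed.

Lemma below_hdiag n x y : letters x -> below n y -> below n.+1 (hd x y).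
Proof.
move=> hx hy; rewrite /ldiag bilin_lin; apply: below_lin => l /hx hl.
by apply: below_lin => u /hy hu; apply: belowU; rewrite len_diagl.
Qed.

Lemma letters_unit l : connected l -> letters (<< l >> : H).
Proof. by move=> hl c /(fsubsetP msuppU_le); rewrite in_fset1 => /eqP->. Qed.

(** Splitting c into its components gives back c, because letter_part fixes
    letters; any coarser splitting gives words with fewer letters. *)
Lemma to_block_below c : below (len c) (to_block c - << c >>).
Proof.
have [n] := ubnP (len c); elim: n c => // n IH c.
elim/bigdiag_ind: c => [|l u hl _ hn].
  by move=> _; rewrite to_block0 subrr; exact: below0.
have IH' v : (len v <= len u)%N -> below (len v).+1 (to_block v).
  move=> hv; rewrite -(subrK << v >> (to_block v)); apply: belowD; last exact: belowU.
  apply: below_le (IH v _) => //; move: hn; rewrite len_diagl // ltnS.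
  exact: leq_ltn_trans.
rewrite to_blockE_neq0 ?diag_eq0 ?(negPf (connected_neq0 hl)) // splits_diagl //.
rewrite big_cons letter_part0 {1}/ldiag bilin0l add0r big_map splits_bigl /=.
rewrite diagc0 letter_part_letter // addrAC len_diagl //; apply: belowD.
  (* The splitting after the first letter contributes the leading term. *)
  have -> : hd << l >> (to_block u) - << diag l u >> = hd << l >> (to_block u - << u >>).
    by rewrite /ldiag linearB /= bilinU.
  apply: below_hdiag; first exact: letters_unit.
  by apply: IH; move: hn; rewrite len_diagl.
rewrite big_seq_cond; apply: below_sum => q /andP[hq q1].
have h := splits_len hq; have h1 := len_gt0 q1.
apply: (@below_le _ _ (len q.2).+2); first by rewrite h ltnS -[X in (X < _)%N]add0n ltn_add2r.
apply: below_hdiag; first exact: letter_part_letters.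
by apply: IH'; rewrite h leq_addl.
Qed.

Theorem shuffle_like_iso : alg_isomorphic mul << e >> bs << e >>.
Proof.
exists (lin to_block); split; first exact/unitriangular_bij/to_block_below.
  by rewrite /= linU to_block0.
move=> x y /=; rewrite -bilin_lin_right (bilin_lin mu) lin_comp bilin_lin.
by apply: eq_lin => a; rewrite lin_comp; apply: eq_lin => b; rewrite /= to_block_mul.
Qed.

End Isomorphism.

(** * Isomorphism of algebras is an equivalence *)

Section AlgIsomorphic.
Variables (K : pzRingType).

Lemma alg_isomorphic_sym (V W : lmodType K) mV (oV : V) mW (oW : W) :
  alg_isomorphic mV oV mW oW -> alg_isomorphic mW oW mV oV.
Proof.
case=> phi [[psi phiK psiK] phi1 phiM].
pose Psi : {linear W -> V} := HB.pack psi
  (GRing.isLinear.Build K W V _ psi (can2_linear phiK psiK)).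
exists Psi; split=> [||x y].
- by exists phi.
- by rewrite -phi1 /= phiK.
- by apply: (can_inj phiK); rewrite phiM /= !psiK.
Qed.

Lemma alg_isomorphic_trans (U V W : lmodType K) mU (oU : U) mV (oV : V) mW (oW : W) :
  alg_isomorphic mU oU mV oV -> alg_isomorphic mV oV mW oW ->
  alg_isomorphic mU oU mW oW.
Proof.
case=> f [fb f1 fM] [g [gb g1 gM]]; exists (g \o f); split=> /=.
- exact: bij_comp.
- by rewrite f1.
- by move=> x y; rewrite fM gM.
Qed.

End AlgIsomorphic.

(** * Entrywise factorizations of a matrix *)

Section Factorizations.
Context (d : nat).
Local Notation M := (cmonom 'I_d).
Local Notation eps := (@mone M).

Definition mxmmul j k (A B : 'M[M]_(j, k)) : 'M[M]_(j, k) :=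
  \matrix_(x, y) mmul (A x y) (B x y).

Lemma mxmmulC j k (A B : 'M[M]_(j, k)) : mxmmul A B = mxmmul B A.
Proof. by apply/matrixP => x y; rewrite !mxE mulmC. Qed.

Lemma mxmmulA j k (A B Z : 'M[M]_(j, k)) :
  mxmmul A (mxmmul B Z) = mxmmul (mxmmul A B) Z.
Proof. by apply/matrixP => x y; rewrite !mxE mulmA. Qed.

(** The factors of Z have exponents bounded by those of Z, so that they range over
    the image of a finite type. *)
Lemma exists_factorizations j k (Z : 'M[M]_(j, k)) :
  {s : seq ('M[M]_(j, k) * 'M[M]_(j, k)) |
    uniq s /\ forall A B, ((A, B) \in s) = (mxmmul A B == Z)}.
Proof.
pose N := (\sum_x \sum_y \sum_l Z x y l)%N.
pose T := {ffun 'I_j * 'I_k * 'I_d -> 'I_N.+1}.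
pose dec (t : T) : 'M[M]_(j, k) :=
  \matrix_(x, y) [cmonom (t (x, y, l) : nat) | l in [fset l | l in 'I_d]%fset]%M.
have decE t x y l : dec t x y l = t (x, y, l).
  by rewrite mxE cmE fsfun_fun !inE.
have bound A B x y l : mxmmul A B = Z -> (A x y l < N.+1)%N.
  move=> E; apply: (@leq_trans (Z x y l).+1).
    by rewrite -E mxE cmM ltnS leq_addr.
  rewrite ltnS /N (bigD1 x) //= (bigD1 y) //= (bigD1 l) //=.
  by rewrite -!addnA leq_addr.
have decK A B : mxmmul A B = Z -> exists t, dec t = A.
  move=> E; exists [ffun i => inord (A i.1.1 i.1.2 i.2)].
  apply/matrixP => x y; apply/eqP/cmP => l.
  by rewrite decE ffunE inordK //; exact: bound E.
exists (undup [seq p <- [seq (dec t.1, dec t.2) | t : T * T]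
               | mxmmul p.1 p.2 == Z]).
split=> [|A B]; first exact: undup_uniq.
rewrite mem_undup mem_filter /= andb_idr // => /eqP E.
have [t tA] := decK A B E.
have [t' tB] : exists t, dec t = B by apply: (decK B A); rewrite mxmmulC.
by apply/imageP; exists (t, t'); rewrite //= tA tB.
Qed.

Definition factorizations j k (Z : 'M[M]_(j, k)) := sval (exists_factorizations Z).

Lemma mem_factorizations j k (Z A B : 'M[M]_(j, k)) :
  ((A, B) \in factorizations Z) = (mxmmul A B == Z).
Proof. exact: (svalP (exists_factorizations Z)).2. Qed.

Lemma uniq_factorizations j k (Z : 'M[M]_(j, k)) : uniq (factorizations Z).
Proof. exact: (svalP (exists_factorizations Z)).1. Qed.

Lemma big_factorizations_swap (V : nmodType) j k (Z : 'M[M]_(j, k))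
    (F : 'M[M]_(j, k) -> 'M[M]_(j, k) -> V) :
  \sum_(p <- factorizations Z) F p.1 p.2 = \sum_(p <- factorizations Z) F p.2 p.1.
Proof.
pose sw (p : 'M[M]_(j, k) * 'M[M]_(j, k)) := (p.2, p.1).
have swK : involutive sw by case.
rewrite (perm_big [seq sw p | p <- factorizations Z]) /= ?big_map //.
apply: uniq_perm; first exact: uniq_factorizations.
  by rewrite (map_inj_uniq (inv_inj swK)) uniq_factorizations.
move=> [A B]; rewrite -[(A, B)]swK (mem_map (inv_inj swK)) /=.
by rewrite !mem_factorizations mxmmulC.
Qed.

(** Both sides run over the ordered factorizations of Z into three matrices. *)
Lemma big_factorizations_assoc (V : nmodType) j k (Z : 'M[M]_(j, k))
    (F : 'M[M]_(j, k) -> 'M[M]_(j, k) -> 'M[M]_(j, k) -> V) :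
  \sum_(p <- factorizations Z) \sum_(q <- factorizations p.1) F q.1 q.2 p.2 =
  \sum_(p <- factorizations Z) \sum_(q <- factorizations p.2) F p.1 q.1 q.2.
Proof.
pose G (t : 'M[M]_(j, k) * 'M[M]_(j, k) * 'M[M]_(j, k)) := F t.1.1 t.1.2 t.2.
transitivity (\sum_(t <- [seq (q.1, q.2, p.2) | p <- factorizations Z, q <- factorizations p.1]) G t).
  by rewrite big_allpairs_dep.
transitivity (\sum_(t <- [seq (p.1, q.1, q.2) | p <- factorizations Z, q <- factorizations p.2]) G t);
  last by rewrite big_allpairs_dep.
apply: perm_big; apply: uniq_perm.
- apply: allpairs_uniq_dep => [|p _|]; rewrite ?uniq_factorizations //.
  move=> /= [p q] [p' q'] /allpairsPdep[x [y [hx hy [-> ->]]]].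
  move=> /allpairsPdep[x' [y' [hx' hy' [-> ->]]]] /=.
  case: x y x' y' hx hy hx' hy' => [x1 x2] [y1 y2] [x1' x2'] [y1' y2'].
  rewrite !mem_factorizations /= => /eqP hx /eqP hy /eqP hx' /eqP hy' [e1 e2 e3].
  by subst.
- apply: allpairs_uniq_dep => [|p _|]; rewrite ?uniq_factorizations //.
  move=> /= [p q] [p' q'] /allpairsPdep[x [y [hx hy [-> ->]]]].
  move=> /allpairsPdep[x' [y' [hx' hy' [-> ->]]]] /=.
  case: x y x' y' hx hy hx' hy' => [x1 x2] [y1 y2] [x1' x2'] [y1' y2'].
  rewrite !mem_factorizations /= => /eqP hx /eqP hy /eqP hx' /eqP hy' [e1 e2 e3].
  by subst.
- move=> [[A B] D]; apply/allpairsPdep/allpairsPdep.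
    move=> [[x1 x2] [[y1 y2]]]; rewrite !mem_factorizations /=.
    move=> [/eqP <- /eqP <- [-> -> ->]].
    by exists (y1, mxmmul y2 x2), (y2, x2); rewrite !mem_factorizations mxmmulA.
  move=> [[x1 x2] [[y1 y2]]]; rewrite !mem_factorizations /=.
  move=> [/eqP <- /eqP <- [-> -> ->]].
  by exists (mxmmul x1 y1, y2), (x1, y1); rewrite !mem_factorizations mxmmulA.
Qed.

Lemma diag_mx2_inj m n s t (A A' : 'M[M]_(m, n)) (B B' : 'M[M]_(s, t)) :
  diag_mx2 A B = diag_mx2 A' B' -> A = A' /\ B = B'.
Proof. by case/eq_block_mx. Qed.

Lemma mxmmul_diag m n s t (A A' : 'M[M]_(m, n)) (B B' : 'M[M]_(s, t)) :
  mxmmul (diag_mx2 A B) (diag_mx2 A' B') = diag_mx2 (mxmmul A A') (mxmmul B B').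
Proof.
apply/matrixP => x y; rewrite mxE; case: (split_ordP x) => u ->;
  case: (split_ordP y) => v ->; rewrite /diag_mx2;
  by rewrite ?block_mxEul ?block_mxEur ?block_mxEdl ?block_mxEdr !mxE ?mul1m.
Qed.

(** An entry of Z equal to the neutral element has only trivial factors. *)
Lemma factor_diag m n s t (X Y : 'M[M]_(m + s, n + t))
    (A : 'M[M]_(m, n)) (B : 'M[M]_(s, t)) :
  mxmmul X Y = diag_mx2 A B -> X = diag_mx2 (ulsubmx X) (drsubmx X).
Proof.
move=> E; rewrite -[LHS]submxK /diag_mx2; congr block_mx;
  apply/matrixP => x y; rewrite !mxE.
- have := congr1 (fun W : 'M__ => W (lshift s x) (rshift n y)) E.
  by rewrite mxE block_mxEur mxE => /unitm[].
- have := congr1 (fun W : 'M__ => W (rshift m x) (lshift t y)) E.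
  by rewrite mxE block_mxEdl mxE => /unitm[].
Qed.

Lemma big_factorizations_diag (V : nmodType) m n s t (A : 'M[M]_(m, n))
    (B : 'M[M]_(s, t)) (F : 'M[M]_(m + s, n + t) -> 'M[M]_(m + s, n + t) -> V) :
  \sum_(p <- factorizations (diag_mx2 A B)) F p.1 p.2 =
  \sum_(p <- factorizations A) \sum_(q <- factorizations B)
    F (diag_mx2 p.1 q.1) (diag_mx2 p.2 q.2).
Proof.
transitivity (\sum_(r <- [seq (diag_mx2 p.1 q.1, diag_mx2 p.2 q.2)
                          | p <- factorizations A, q <- factorizations B]) F r.1 r.2);
  last by rewrite big_allpairs_dep.
apply: perm_big; apply: uniq_perm; first exact: uniq_factorizations.
  apply: allpairs_uniq; rewrite ?uniq_factorizations //.
  by move=> [[p1 p2] [q1 q2]] [[p1' p2'] [q1' q2']] _ _ /= []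
     /eq_block_mx[-> _ _ ->] /eq_block_mx[-> _ _ ->].
move=> [X Y]; rewrite mem_factorizations; apply/eqP/allpairsPdep.
  move=> E; have hX := factor_diag E.
  have hY : Y = diag_mx2 (ulsubmx Y) (drsubmx Y).
    by apply: (@factor_diag _ _ _ _ _ X A B); rewrite mxmmulC.
  exists (ulsubmx X, ulsubmx Y), (drsubmx X, drsubmx Y).
  have [e1 e2] : mxmmul (ulsubmx X) (ulsubmx Y) = A /\
                 mxmmul (drsubmx X) (drsubmx Y) = B.
    by apply: diag_mx2_inj; rewrite -mxmmul_diag -hX -hY.
  by rewrite !mem_factorizations e1 e2 !eqxx /= -hX -hY.
move=> [[p1 p2] [[q1 q2]]]; rewrite !mem_factorizations /= => -[/eqP<- /eqP<- [-> ->]].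
exact: mxmmul_diag.
Qed.

End Factorizations.

(** * Deleting the trivial rows and columns of a matrix *)

Section Compression.
Context (d : nat).
Local Notation M := (cmonom 'I_d).
Local Notation eps := (@mone M).
Local Notation C := (mcomp d).

Definition incr m j (al : 'I_m -> 'I_j) := forall u v : 'I_m, (u < v)%N -> (al u < al v)%N.

Lemma incr_inj m j (al : 'I_m -> 'I_j) : incr al -> injective al.
Proof.
move=> h u v E; apply: ord_inj; case: (ltngtP u v) => // /h.
  by rewrite E ltnn.
by rewrite E ltnn.
Qed.

(** An increasing map is the sorted enumeration of its image. *)
Lemma incr_image_inj m m' j (al : 'I_m -> 'I_j) (al' : 'I_m' -> 'I_j) :
  incr al -> incr al' ->
  (forall x, (exists u, al u = x) <-> (exists u, al' u = x)) ->
  m = m' /\ forall (u : 'I_m) (u' : 'I_m'), u = u' :> nat -> al u = al' u'.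
Proof.
move=> h h' im.
pose s n (be : 'I_n -> 'I_j) := [seq val (be u) | u <- enum 'I_n].
have sorted_s n (be : 'I_n -> 'I_j) : incr be -> sorted ltn (s n be).
  move=> hbe; rewrite sorted_map; apply: (@sub_sorted _ (relpre val ltn)).
    by move=> u v; exact: hbe.
  by rewrite -sorted_map val_enum_ord iota_ltn_sorted.
have E : s m al = s m' al'.
  apply: (irr_sorted_eq ltn_trans ltnn); rewrite ?sorted_s // => x.
  apply/mapP/mapP => -[u _ ->].
    have [u' h'u] := (im (al u)).1 (ex_intro _ u erefl).
    by exists u'; rewrite ?mem_enum ?h'u.
  have [u' hu] := (im (al' u)).2 (ex_intro _ u erefl).
  by exists u'; rewrite ?mem_enum ?hu.
have ss n (be : 'I_n -> 'I_j) : size (s n be) = n.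
  by rewrite size_map size_enum_ord.
have mm : m = m' by rewrite -(ss m al) E ss.
split=> // u u' uu; apply: val_inj => /=.
have sE n (be : 'I_n -> 'I_j) (v : 'I_n) : nth 0%N (s n be) v = be v.
  by rewrite (nth_map v) ?size_enum_ord // nth_ord_enum.
by rewrite -sE E uu sE.
Qed.

(** A is Z with some of its trivial rows and columns deleted, the remaining ones
    being given by al and be. *)
Definition emb m n j k (al : 'I_m -> 'I_j) (be : 'I_n -> 'I_k)
    (A : 'M[M]_(m, n)) (Z : 'M[M]_(j, k)) :=
  (forall u v, Z (al u) (be v) = A u v) /\
  (forall x y, Z x y != eps -> (exists u, al u = x) /\ (exists v, be v = y)).

Lemma emb_comp m n j k r s (al : 'I_m -> 'I_j) (be : 'I_n -> 'I_k)
    (al' : 'I_j -> 'I_r) (be' : 'I_k -> 'I_s) A Z W :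
  emb al be A Z -> emb al' be' Z W -> emb (al' \o al) (be' \o be) A W.
Proof.
move=> [h1 h2] [h1' h2']; split=> [u v|x y hxy]; first by rewrite /= h1' h1.
have [[u' ux] [v' vy]] := h2' _ _ hxy; subst.
have [[u <-] [v <-]] := h2 u' v' ltac:(by rewrite -h1').
by split; [exists u | exists v].
Qed.

(** Merging along injective maps inserts trivial rows and columns. *)
Lemma emb_merge_mx m n j k (al : 'I_m -> 'I_j) (be : 'I_n -> 'I_k) A :
  injective al -> injective be -> emb al be A (merge_mx A al be).
Proof.
move=> hal hbe; split=> [u v|x y].
  rewrite mxE (big_pred1 u) => [|u']; last by rewrite /= (inj_eq hal).
  by rewrite (big_pred1 v) // => v'; rewrite /= (inj_eq hbe).
rewrite mxE => h; split; apply: contrapT => H; case/negP: h.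
  rewrite big_pred0 // => u; apply/eqP => E; apply: H; by exists u.
rewrite big1 // => u _; rewrite big_pred0 // => v.
by apply/eqP => E; apply: H; exists v.
Qed.

(** The composition a is what remains of Z when all its trivial rows and columns
    are deleted, as a composition has none of its own. *)
Definition is_comp (a : C) j k (Z : 'M[M]_(j, k)) :=
  exists al be, [/\ incr al, incr be & emb al be (comp_mx a) Z].

Lemma emb_rows (a : C) j k (Z : 'M[M]_(j, k)) al be :
  emb al be (comp_mx a) Z ->
  forall x, (exists u, al u = x) <-> (exists y, Z x y != eps).
Proof.
move=> [h1 h2] x; split=> [[u <-]|[y /h2[]//]].
have [/(_ u)[v hv] _] := no_eps_lineP _ (comp_mxP a).
by exists (be v); rewrite h1.
Qed.

Lemma emb_cols (a : C) j k (Z : 'M[M]_(j, k)) al be :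
  emb al be (comp_mx a) Z ->
  forall y, (exists v, be v = y) <-> (exists x, Z x y != eps).
Proof.
move=> [h1 h2] y; split=> [[v <-]|[x /h2[]//]].
have [_ /(_ v)[u hu]] := no_eps_lineP _ (comp_mxP a).
by exists (al u); rewrite h1.
Qed.

(** The images of al and be are the nontrivial rows and columns of Z, hence are
    determined by Z. *)
Lemma emb_uniq (a a' : C) j k (Z : 'M[M]_(j, k)) al be al' be' :
  incr al -> incr be -> emb al be (comp_mx a) Z ->
  incr al' -> incr be' -> emb al' be' (comp_mx a') Z ->
  [/\ a = a',
      forall (u : 'I_(nrow a)) (u' : 'I_(nrow a')), u = u' :> nat -> al u = al' u' &
      forall (v : 'I_(ncol a)) (v' : 'I_(ncol a')), v = v' :> nat -> be v = be' v'].
Proof.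
move=> ial ibe h ial' ibe' h'.
have [rE alE] := incr_image_inj ial ial'
  (fun x => iff_trans (emb_rows h x) (iff_sym (emb_rows h' x))).
have [cE beE] := incr_image_inj ibe ibe'
  (fun x => iff_trans (emb_cols h x) (iff_sym (emb_cols h' x))).
split=> //; apply: comp_eq => // x y.
have [hx|hx] := ltnP x (nrow a); last by rewrite !entry_row // -rE.
have [hy|hy] := ltnP y (ncol a); last by rewrite !entry_col // -cE.
have hx' := hx; rewrite rE in hx'; have hy' := hy; rewrite cE in hy'.
have /= -> := entryE (c := a) (Ordinal hx) (Ordinal hy).
have /= -> := entryE (c := a') (Ordinal hx') (Ordinal hy').
by rewrite -h.1 -h'.1; congr (Z _ _); [apply: alE|apply: beE].
Qed.

Lemma is_comp_inj (a a' : C) j k (Z : 'M[M]_(j, k)) :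
  is_comp a Z -> is_comp a' Z -> a = a'.
Proof.
move=> [al [be [h1 h2 h3]]] [al' [be' [h1' h2' h3']]].
by have [] := emb_uniq h1 h2 h3 h1' h2' h3'.
Qed.

Lemma incr_enum_val j (R : {set 'I_j}) : incr (@enum_val _ (mem R)).
Proof.
have sR : sorted ltn [seq val u | u <- enum R].
  rewrite sorted_map {1}/enum_mem; apply: sorted_filter.
    by move=> u v w; exact: ltn_trans.
  by rewrite -enumT -sorted_map val_enum_ord iota_ltn_sorted.
move=> u v uv; have h (w : 'I_#|R|) : (w < size (enum R))%N by rewrite -cardE.
rewrite /enum_val -!(nth_map _ 0%N val) //.
by apply: (sorted_ltn_nth ltn_trans) => //; rewrite inE size_map.
Qed.

Lemma exists_compress j k (Z : 'M[M]_(j, k)) : {a : C | is_comp a Z}.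
Proof.
apply: cid.
pose R := [set x | [exists y, Z x y != eps]].
pose S := [set y | [exists x, Z x y != eps]].
pose A : 'M[M]_(#|R|, #|S|) :=
  \matrix_(u, v) Z (@enum_val _ (mem R) u) (@enum_val _ (mem S) v).
have inR x y : Z x y != eps -> x \in R by move=> h; rewrite inE; apply/existsP; exists y.
have inS x y : Z x y != eps -> y \in S by move=> h; rewrite inE; apply/existsP; exists x.
have enumR x : x \in R -> exists u, @enum_val _ (mem R) u = x.
  by move=> h; exists (enum_rank_in h x); rewrite enum_rankK_in.
have enumS x : x \in S -> exists u, @enum_val _ (mem S) u = x.
  by move=> h; exists (enum_rank_in h x); rewrite enum_rankK_in.
have hA : no_eps_line A.
  apply/no_eps_lineP; split=> [u|v].
    have := enum_valP u; rewrite inE => /existsP[y hy].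
    by have [v hv] := enumS _ (inS _ _ hy); exists v; rewrite mxE hv.
  have := enum_valP v; rewrite inE => /existsP[x hx].
  by have [u hu] := enumR _ (inR _ _ hx); exists u; rewrite mxE hu.
exists (mkcomp hA), (@enum_val _ (mem R)), (@enum_val _ (mem S)).
split; [exact: incr_enum_val | exact: incr_enum_val | split].
  by move=> u v; rewrite [RHS]mxE.
by move=> x y h; split; [apply/enumR/inR/h | apply/enumS/inS/h].
Qed.

Definition compress j k (Z : 'M[M]_(j, k)) : C := sval (exists_compress Z).

Lemma compressP j k (Z : 'M[M]_(j, k)) : is_comp (compress Z) Z.
Proof. exact: (svalP (exists_compress Z)). Qed.

Lemma compress_eq (a : C) j k (Z : 'M[M]_(j, k)) : is_comp a Z -> compress Z = a.
Proof. exact/is_comp_inj/compressP. Qed.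

Lemma compress_comp_mx (a : C) : compress (comp_mx a) = a.
Proof.
apply: compress_eq; exists id, id; split=> //; split=> // x y _.
by split; [exists x|exists y].
Qed.

Lemma compress_emb m n j k (al : 'I_m -> 'I_j) (be : 'I_n -> 'I_k)
    (A : 'M[M]_(m, n)) (Z : 'M[M]_(j, k)) :
  incr al -> incr be -> emb al be A Z -> compress Z = compress A.
Proof.
move=> ial ibe hZ; apply: compress_eq.
have [al' [be' [ial' ibe' hA]]] := compressP A.
exists (al \o al'), (be \o be'); split; last exact: emb_comp hA hZ.
- by move=> u v /ial'/ial.
- by move=> u v /ibe'/ibe.
Qed.

Definition osum m s j r (al : 'I_m -> 'I_j) (al' : 'I_s -> 'I_r) (u : 'I_(m + s)) :
    'I_(j + r) :=
  match split u with inl i => lshift r (al i) | inr i => rshift j (al' i) end.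

Lemma osum_lshift m s j r (al : 'I_m -> 'I_j) (al' : 'I_s -> 'I_r) u :
  osum al al' (lshift s u) = lshift r (al u).
Proof. by rewrite /osum -[lshift s u]/(unsplit (inl u)) unsplitK. Qed.

Lemma osum_rshift m s j r (al : 'I_m -> 'I_j) (al' : 'I_s -> 'I_r) u :
  osum al al' (rshift m u) = rshift j (al' u).
Proof. by rewrite /osum -[rshift m u]/(unsplit (inr u)) unsplitK. Qed.

Definition osumE := (osum_lshift, osum_rshift).

Lemma incr_osum m s j r (al : 'I_m -> 'I_j) (al' : 'I_s -> 'I_r) :
  incr al -> incr al' -> incr (osum al al').
Proof.
move=> h h' u v; case: (split_ordP u) => i ->; case: (split_ordP v) => i' -> /=.
- by rewrite !osumE /=; exact: h.
- by rewrite !osumE /= => _; rewrite ltn_addr.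
- by move=> uv; have := leq_trans uv (ltnW (ltn_ord i')); rewrite ltnNge leq_addr.
- by rewrite !osumE /= !ltn_add2l; exact: h'.
Qed.

Lemma emb_diag m n j k m' n' j' k' (al : 'I_m -> 'I_j) (be : 'I_n -> 'I_k)
    (al' : 'I_m' -> 'I_j') (be' : 'I_n' -> 'I_k') A Z A' Z' :
  emb al be A Z -> emb al' be' A' Z' ->
  emb (osum al al') (osum be be') (diag_mx2 A A') (diag_mx2 Z Z').
Proof.
move=> [h1 h2] [h1' h2']; split=> x y.
  case: (split_ordP x) => u ->; case: (split_ordP y) => v ->; rewrite !osumE;
  by rewrite /diag_mx2 ?block_mxEul ?block_mxEur ?block_mxEdl ?block_mxEdr ?mxE.
case: (split_ordP x) => u ->; case: (split_ordP y) => v ->;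
  rewrite /diag_mx2 ?block_mxEul ?block_mxEur ?block_mxEdl ?block_mxEdr ?mxE ?eqxx //.
  case/h2 => -[u' <-] [v' <-].
  by split; [exists (lshift _ u') | exists (lshift _ v')]; rewrite osumE.
case/h2' => -[u' <-] [v' <-].
by split; [exists (rshift _ u') | exists (rshift _ v')]; rewrite osumE.
Qed.

Lemma compress_diag j k j' k' (Z : 'M[M]_(j, k)) (Z' : 'M[M]_(j', k')) :
  compress (diag_mx2 Z Z') = diag (compress Z) (compress Z').
Proof.
apply: compress_eq.
have [al [be [ial ibe h]]] := compressP Z; have [al' [be' [ial' ibe' h']]] := compressP Z'.
exists (osum al al'), (osum be be').
by split; [exact: incr_osum | exact: incr_osum | exact: (emb_diag h h')].
Qed.

(** A factor of Z is trivial in the trivial rows and columns of Z. Reinserting them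
    is thus a bijection from the factorizations of the compressed matrix to those
    of Z, and it does not change what the factors compress to. *)
Lemma big_factorizations_compress (V : nmodType) j k (Z : 'M[M]_(j, k)) (F : C -> C -> V) :
  \sum_(p <- factorizations Z) F (compress p.1) (compress p.2) =
  \sum_(p <- factorizations (comp_mx (compress Z))) F (compress p.1) (compress p.2).
Proof.
have [al [be [ial ibe hZ]]] := compressP Z.
have [jal jbe] := (incr_inj ial, incr_inj ibe).
pose push (A : 'M[M]_(nrow (compress Z), ncol (compress Z))) := merge_mx A al be.
have hpush A : emb al be A (push A) by exact: emb_merge_mx.
have compush A : compress (push A) = compress A by apply: compress_emb (hpush A).
have push_inj : injective push.
  move=> A B E; apply/matrixP => u v.
  by rewrite -(hpush A).1 -(hpush B).1 E.
pose push2 p := (push p.1, push p.2).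
have push2_inj : injective push2.
  by move=> [p1 p2] [q1 q2] [/push_inj-> /push_inj->].
rewrite (perm_big [seq push2 p | p <- factorizations (comp_mx (compress Z))]) /= ?big_map.
  by apply: eq_bigr => p _; rewrite !compush.
apply: uniq_perm; first exact: uniq_factorizations.
  by rewrite map_inj_uniq ?uniq_factorizations.
have outside (W : 'M[M]_(j, k)) :
    (forall x y, W x y != eps -> (exists u, al u = x) /\ (exists v, be v = y)) ->
    W = push (\matrix_(u, v) W (al u) (be v)).
  move=> hW; apply/matrixP => x y.
  set A := (\matrix_(u, v) _).
  have [hxy|] := eqVneq (push A x y) eps.
    have [->//|] := eqVneq (W x y) eps => W0; have [[u ux] [v vy]] := hW _ _ W0.
    by rewrite -ux -vy (hpush A).1 mxE.
  by case/(hpush A).2 => -[u <-] [v <-]; rewrite (hpush A).1 mxE.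
move=> [X Y]; rewrite mem_factorizations; apply/eqP/mapP => [E|[[A B]]].
  have hXY x y : (X x y != eps) || (Y x y != eps) ->
      (exists u, al u = x) /\ (exists v, be v = y).
    move=> h; apply: hZ.2; rewrite -E mxE; apply: contraL h => /eqP/unitm[-> ->].
    by rewrite eqxx.
  exists ((\matrix_(u, v) X (al u) (be v)), (\matrix_(u, v) Y (al u) (be v))).
    rewrite mem_factorizations; apply/eqP/matrixP => u v.
    by rewrite !mxE -hZ.1 -E mxE.
  congr (_, _); apply: outside => x y h; apply: hXY.
    by rewrite h.
  by rewrite h orbT.
rewrite mem_factorizations => /eqP E [-> ->]; apply/matrixP => x y; rewrite mxE.
have [hxy|hxy] := pselect ((exists u, al u = x) /\ (exists v, be v = y)).
  case: hxy => -[u <-] [v <-].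
  by rewrite (hpush A).1 (hpush B).1 hZ.1 -E mxE.
have out W : (W x y != eps -> (exists u, al u = x) /\ (exists v, be v = y)) ->
   W x y = eps.
  by move=> h; have [//|/h] := eqVneq (W x y) eps.
by rewrite (out _ ((hpush A).2 x y)) (out _ ((hpush B).2 x y)) (out _ (hZ.2 x y)) mul1m.
Qed.

End Compression.

(** * Degree and size of a composition *)

Section MatrixStatistics.
Context (d : nat).
Local Notation M := (cmonom 'I_d).
Local Notation eps := (@mone M).
Local Notation C := (mcomp d).
Local Notation e := (cempty d).

Definition mxdeg j k (Z : 'M[M]_(j, k)) : nat := (\sum_x \sum_y mdeg (Z x y))%N.

(** Additive for the quasi-shuffle as well as for the shuffle, unlike the numbers
    of rows and columns. *)
Definition cdeg (c : C) := mxdeg (comp_mx c).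

Lemma big_inj_support m j (al : 'I_m -> 'I_j) (F : 'I_j -> nat) :
  injective al -> (forall x, F x != 0%N -> exists u, al u = x) ->
  (\sum_x F x = \sum_u F (al u))%N.
Proof.
move=> ial h; rewrite (bigID [in al @: setT]) /= [X in (_ + X)%N]big1 ?addn0.
  rewrite big_imset /=; last by move=> u v _ _ /ial.
  by apply: eq_bigl => u; rewrite inE.
move=> x; apply: contraNeq => /h[u <-]; exact: imset_f.
Qed.

Lemma mxdeg_compress j k (Z : 'M[M]_(j, k)) : mxdeg Z = cdeg (compress Z).
Proof.
have [al [be [/incr_inj ial /incr_inj ibe [h1 h2]]]] := compressP Z.
have supp x y : mdeg (Z x y) != 0%N ->
    (exists u, al u = x) /\ (exists v, be v = y).
  by rewrite mdeg_eq0 => /h2.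
rewrite /cdeg /mxdeg (big_inj_support ial) => [|x].
  apply: eq_bigr => u _; rewrite (big_inj_support ibe) => [|y /supp[]//].
  by apply: eq_bigr => v _; rewrite h1.
apply: contra_neqP => hx; rewrite big1 // => y _.
by apply/eqP; apply: contra_notT hx => /supp[].
Qed.

Lemma mxdegM j k (X Y : 'M[M]_(j, k)) :
  mxdeg (mxmmul X Y) = (mxdeg X + mxdeg Y)%N.
Proof.
rewrite /mxdeg -big_split; apply: eq_bigr => x _ /=.
by rewrite -big_split; apply: eq_bigr => y _; rewrite mxE mdegM.
Qed.

Lemma cdeg_eq0 (c : C) : (cdeg c == 0%N) = (c == e).
Proof.
apply/eqP/eqP => [h|->]; last by rewrite /cdeg /mxdeg big_ord0.
apply: nrow_eq0; case: (posnP (nrow c)) => // hr.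
have [/(_ (Ordinal hr))[y hy] _] := no_eps_lineP _ (comp_mxP c).
case/negP: hy; rewrite -mdeg_eq0; apply/eqP; move: h; rewrite /cdeg /mxdeg.
by rewrite (bigD1 (Ordinal hr)) //= (bigD1 y) //=; lia.
Qed.

(** The numbers of rows and of columns are subadditive separately, so that a single
    number suffices to say that both are additive. *)
Definition csize (c : C) : nat := (nrow c + ncol c)%N.

Definition support_rows j k (Z : 'M[M]_(j, k)) :=
  [set x | [exists y, Z x y != eps]].
Definition support_cols j k (Z : 'M[M]_(j, k)) :=
  [set y | [exists x, Z x y != eps]].

Lemma nrow_compress j k (Z : 'M[M]_(j, k)) : nrow (compress Z) = #|support_rows Z|.
Proof.
have [al [be [ial _ hZ]]] := compressP Z.
have -> : support_rows Z = al @: setT.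
  apply/setP => x; rewrite inE; apply/existsP/imsetP.
    by move/(emb_rows hZ x) => [u <-]; exists u; rewrite ?inE.
  by case=> u _ ->; apply/(emb_rows hZ); exists u.
by rewrite card_imset ?cardsT ?card_ord //; exact: incr_inj.
Qed.

Lemma ncol_compress j k (Z : 'M[M]_(j, k)) : ncol (compress Z) = #|support_cols Z|.
Proof.
have [al [be [_ ibe hZ]]] := compressP Z.
have -> : support_cols Z = be @: setT.
  apply/setP => y; rewrite inE; apply/existsP/imsetP.
    by move/(emb_cols hZ y) => [v <-]; exists v; rewrite ?inE.
  by case=> v _ ->; apply/(emb_cols hZ); exists v.
by rewrite card_imset ?cardsT ?card_ord //; exact: incr_inj.
Qed.

Lemma nrow_compressM j k (X Y : 'M[M]_(j, k)) :
  (nrow (compress (mxmmul X Y)) <= nrow (compress X) + nrow (compress Y))%N.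
Proof.
rewrite !nrow_compress; apply: leq_trans (leq_card_setU _ _).
apply/subset_leq_card/subsetP => x; rewrite !inE => /existsP[y]; rewrite mxE => h.
have [X1|hX] := eqVneq (X x y) eps; last by apply/orP; left; apply/existsP; exists y.
by apply/orP; right; apply/existsP; exists y; rewrite X1 mul1m in h.
Qed.

Lemma ncol_compressM j k (X Y : 'M[M]_(j, k)) :
  (ncol (compress (mxmmul X Y)) <= ncol (compress X) + ncol (compress Y))%N.
Proof.
rewrite !ncol_compress; apply: leq_trans (leq_card_setU _ _).
apply/subset_leq_card/subsetP => y; rewrite !inE => /existsP[x]; rewrite mxE => h.
have [X1|hX] := eqVneq (X x y) eps; last by apply/orP; left; apply/existsP; exists x.
by apply/orP; right; apply/existsP; exists x; rewrite X1 mul1m in h.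
Qed.

Lemma csize_diag (a b : C) : csize (diag a b) = (csize a + csize b)%N.
Proof. by rewrite /csize [LHS]addnACA. Qed.

Lemma compress_eq0 j k (Z : 'M[M]_(j, k)) : (compress Z == e) = (Z == const_mx eps).
Proof.
apply/eqP/eqP => [E|->].
  have := compressP Z; rewrite E => -[al [be [_ _ [_ h]]]].
  by apply/matrixP => x y; rewrite mxE; have [//|/h[[[]]]] := eqVneq (Z x y) eps.
apply: compress_eq; pose no n (u : 'I_0) : 'I_n := False_rect _ (notF (ltn_ord u)).
exists (@no j), (@no k); split=> [[]//|[]//|]; split=> [[]//|x y].
by rewrite mxE eqxx.
Qed.

End MatrixStatistics.

(** * Structure constants of the quasi-shuffle *)

Section StructureConstants.
Context (d : nat) (K : comNzRingType).
Local Notation M := (cmonom 'I_d).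
Local Notation eps := (@mone M).
Local Notation C := (mcomp d).
Local Notation H := {malg K[C]}.
Local Notation e := (cempty d).

(** For a composition Z this is the coefficient of Z in the quasi-shuffle of a
    and b: the two blocks of rows of a quasi-shuffle place the rows of a and
    those of b among the rows of Z, likewise for the columns, and Z is the
    entrywise product of the two matrices so obtained. *)
Definition factor_count (a b : C) j k (Z : 'M[M]_(j, k)) : K :=
  \sum_(p <- factorizations Z) ((compress p.1 == a) && (compress p.2 == b))%:R.

Lemma factor_count_supp (a b : C) j k (Z : 'M[M]_(j, k)) : factor_count a b Z != 0 ->
  exists X Y, [/\ mxmmul X Y = Z, compress X = a & compress Y = b].
Proof.
move=> h; apply: contrapT => H; case/negP: h; apply/eqP.
rewrite /factor_count big1_seq // => -[X Y] /andP[_]; rewrite mem_factorizations => /eqP hXY /=.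
case: andP => // -[/eqP hX /eqP hY]; case: H; by exists X, Y.
Qed.

Lemma factor_countC (a b : C) j k (Z : 'M[M]_(j, k)) : factor_count a b Z = factor_count b a Z.
Proof.
rewrite /factor_count (big_factorizations_swap Z
  (fun X Y => ((compress X == a) && (compress Y == b))%:R)).
by apply: eq_bigr => p _; rewrite andbC.
Qed.

Lemma factor_count_compress (a b : C) j k (Z : 'M[M]_(j, k)) :
  factor_count a b Z = factor_count a b (comp_mx (compress Z)).
Proof.
exact: (big_factorizations_compress Z (fun x y => ((x == a) && (y == b))%:R)).
Qed.

Lemma mxmmul1 j k (Z : 'M[M]_(j, k)) : mxmmul (const_mx eps) Z = Z.
Proof. by apply/matrixP => x y; rewrite !mxE mul1m. Qed.

Lemma factor_count_unit (b c : C) : factor_count e b (comp_mx c) = (b == c)%:R.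
Proof.
rewrite /factor_count (bigD1_seq (const_mx eps, comp_mx c)) ?uniq_factorizations //=; last first.
  by rewrite mem_factorizations mxmmul1.
rewrite big1_seq => [|[X Y] /andP[/negP ne]].
  by rewrite addr0 compress_eq0 eqxx compress_comp_mx eq_sym.
rewrite mem_factorizations => /eqP hXY /=; rewrite compress_eq0.
case: eqP => //= hX; case: ne; apply/eqP.
by rewrite -hXY hX mxmmul1.
Qed.

(** Both sides count the factorizations of Z into three matrices compressing to a,
    b and c; a cyclic permutation is the shape in which associativity follows from
    commutativity. *)
Lemma factor_count_assoc (a b c : C) j k (Z : 'M[M]_(j, k)) :
  \sum_(p <- factorizations Z) factor_count a b p.1 * (compress p.2 == c)%:R =
  \sum_(p <- factorizations Z) factor_count b c p.1 * (compress p.2 == a)%:R.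
Proof.
rewrite [RHS](big_factorizations_swap Z (fun X Y => factor_count b c X * (compress Y == a)%:R)).
under eq_bigr do rewrite mulr_suml.
under [RHS]eq_bigr do rewrite mulr_suml.
rewrite (big_factorizations_assoc Z (fun X Y W =>
  ((compress X == a) && (compress Y == b))%:R * (compress W == c)%:R)).
apply: eq_bigr => p _; apply: eq_bigr => q _.
by rewrite -!natrM !mulnb; congr (_%:R); rewrite [in RHS]andbC andbA.
Qed.

Lemma sum_splits_diag (a x y : C) :
  \sum_(p <- splits a) ((x == p.1) && (y == p.2))%:R = (diag x y == a)%:R :> K.
Proof.
rewrite -mem_splits.
transitivity (\sum_(p <- splits a) ((x, y) == p)%:R : K).
  by apply: eq_bigr => -[u v] _; rewrite xpair_eqE.
exact/sum_eq_mem/uniq_splits.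
Qed.

(** Factorizations of a block diagonal matrix are block diagonal, and compression
    acts on the blocks. *)
Lemma factor_count_diag (a b : C) m n s t (X : 'M[M]_(m, n)) (Y : 'M[M]_(s, t)) :
  factor_count a b (diag_mx2 X Y) =
  \sum_(p <- splits a) \sum_(q <- splits b) factor_count p.1 q.1 X * factor_count p.2 q.2 Y.
Proof.
rewrite /factor_count (big_factorizations_diag X Y (fun Z W =>
  ((compress Z == a) && (compress W == b))%:R)).
under [RHS]eq_bigr => p _ do under eq_bigr => q _ do rewrite mulr_suml.
under [RHS]eq_bigr => p _ do rewrite exchange_big.
rewrite [RHS]exchange_big; apply: eq_bigr => -[X1 X2] _ /=.
under [RHS]eq_bigr => p _ do under eq_bigr => q _ do rewrite mulr_sumr.
under [RHS]eq_bigr => p _ do rewrite exchange_big.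
rewrite [RHS]exchange_big; apply: eq_bigr => -[Y1 Y2] _ /=.
rewrite !compress_diag -mulnb natrM -!sum_splits_diag mulr_suml.
apply: eq_bigr => p _; rewrite mulr_sumr; apply: eq_bigr => q _.
by rewrite -!natrM !mulnb; congr (_%:R); rewrite andbACA.
Qed.

Lemma factor_count_bounds (a b c : C) : factor_count a b (comp_mx c) != 0 ->
  [/\ (nrow a <= nrow c)%N, (ncol a <= ncol c)%N,
      (nrow c <= nrow a + nrow b)%N & (ncol c <= ncol a + ncol b)%N].
Proof.
move=> /factor_count_supp[X [Y [hZ <- <-]]].
have := nrow_compressM X Y; have := ncol_compressM X Y.
rewrite hZ compress_comp_mx => h2 h1.
by split=> //; rewrite ?nrow_compress ?ncol_compress;
  apply: leq_trans (max_card _) _; rewrite card_ord.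
Qed.

Section QuasiShuffle.
Variable mu : C -> C -> H.
Hypothesis muE : forall a b c, (mu a b)@_c = factor_count a b (comp_mx c).

Lemma sum_mcoeff_eq (D : choiceType) (x : {malg K[D]}) (c : D) :
  \sum_(a <- msupp x) x@_a * (c == a)%:R = x@_c.
Proof.
rewrite -[in RHS](lin_id x) mcoeff_lin; apply: eq_bigr => a _.
by rewrite mcoeffU eq_sym.
Qed.

(** Factorizations of the intermediate composition can be transported to the
    matrix that compresses to it, which makes the iterated product a sum over
    iterated factorizations of g alone. *)
Lemma mcoeff_mul3 a b c g : (bilin mu (mu a b) << c >>)@_g =
  \sum_(p <- factorizations (comp_mx g)) factor_count a b p.1 * (compress p.2 == c)%:R.
Proof.
rewrite bilinUr mcoeff_lin.
under eq_bigr => x _ do rewrite muE /factor_count mulr_sumr.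
rewrite exchange_big; apply: eq_bigr => -[X Y] _ /=.
rewrite factor_count_compress -muE -[in RHS]sum_mcoeff_eq mulr_suml.
by apply: eq_bigr => x _; rewrite -mulnb natrM mulrA.
Qed.

Lemma shuffle_like_factor_count : shuffle_like (@cdeg d) mu.
Proof.
split.
- by move=> c; apply/malgP => c'; rewrite muE factor_count_unit mcoeffU.
- by move=> a b; apply/malgP => c; rewrite !muE factor_countC.
- move=> a b c; apply/malgP => g; rewrite mcoeff_mul3 factor_count_assoc -mcoeff_mul3.
  rewrite bilinUl bilinUr; congr (_@_g); apply: eq_lin => x.
  by apply/malgP => c'; rewrite !muE factor_countC.
- move=> a b c1 c2; rewrite muE [comp_mx _]/(diag_mx2 _ _) factor_count_diag.
  by apply: eq_bigr => p _; apply: eq_bigr => q _; rewrite !muE.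
- move=> a b c; rewrite -mcoeff_neq0 muE => /factor_count_supp[X [Y [hZ <- <-]]].
  by rewrite -!mxdeg_compress -mxdegM hZ.
Qed.

Lemma csize_supp a b c : c \in msupp (mu a b) -> (csize c <= csize a + csize b)%N.
Proof.
rewrite -mcoeff_neq0 muE => /factor_count_bounds[_ _ h1 h2].
by rewrite /csize addnACA leq_add.
Qed.

End QuasiShuffle.
End StructureConstants.

(** * The top component of a filtered product *)

Section TopComponent.
Context (d : nat) (K : comNzRingType).
Local Notation C := (mcomp d).
Local Notation H := {malg K[C]}.
Local Notation e := (cempty d).
Variables (deg nu : C -> nat) (mu mu' : C -> C -> H).
Hypothesis hmu : shuffle_like deg mu.
Hypothesis nu_diag : forall a b, nu (diag a b) = (nu a + nu b)%N.
Hypothesis nu_supp : forall a b c, c \in msupp (mu a b) -> (nu c <= nu a + nu b)%N.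
Hypothesis mu'E : forall a b c,
  (mu' a b)@_c = if nu c == (nu a + nu b)%N then (mu a b)@_c else 0.

Lemma nu0 : nu e = 0%N.
Proof. by have := nu_diag e e; rewrite diag0c; lia. Qed.

(** If nu is subadditive at both steps, the total is additive exactly when each
    step is. *)
Lemma mcoeff_top3 a b c g : (bilin mu' (mu' a b) << c >>)@_g =
  if nu g == (nu a + nu b + nu c)%N then (bilin mu (mu a b) << c >>)@_g else 0.
Proof.
rewrite !bilinUr (linEw _ (D := msupp (mu a b))); last first.
  by apply/fsubsetP => x; rewrite -!mcoeff_neq0 mu'E; case: ifP; rewrite ?eqxx.
rewrite mcoeff_lin raddf_sum /=.
rewrite (_ : (if _ then _ else 0) = \sum_(x <- msupp (mu a b))
  if nu g == (nu a + nu b + nu c)%N then (mu a b)@_x * (mu x c)@_g else 0);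
  last by case: ifP => // _; rewrite big1.
apply: eq_big_seq => x /nu_supp hx; rewrite mcoeffZ !mu'E.
have [->|] := eqVneq ((mu x c)@_g) 0; first by rewrite !mulr0 !if_same mulr0.
rewrite mcoeff_neq0 => /nu_supp hg.
case: eqP => h1; case: eqP => h2; case: eqP => h3; rewrite ?mul0r ?mulr0 //; lia.
Qed.

(** Each axiom for mu splits according to the values of nu, and its part in which nu
    is additive is the axiom for the top component. *)
Lemma shuffle_like_top : shuffle_like deg mu'.
Proof.
have comm' a b : mu' a b = mu' b a.
  by apply/malgP => c; rewrite !mu'E (mu_comm hmu) addnC.
split=> //.
- move=> c; apply/malgP => c'; rewrite mu'E (mu_unit hmu) nu0 add0n mcoeffU.
  by case: eqP => // h; case: eqP => // E; case: h; rewrite E.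
- move=> a b c; apply/malgP => g; rewrite mcoeff_top3.
  have -> : bilin mu' << a >> (mu' b c) = bilin mu' (mu' b c) << a >>.
    by rewrite bilinUl bilinUr; apply: eq_lin => x.
  rewrite mcoeff_top3 (mu_assoc hmu) (mul_comm hmu) addnC addnA.
  by case: ifP => h1; case: ifP => h2 //; lia.
- move=> a b c1 c2; rewrite mu'E nu_diag (mu_deconc hmu).
  rewrite (_ : (if _ then _ else 0) = \sum_(p <- splits a) \sum_(q <- splits b)
    if (nu c1 + nu c2 == nu a + nu b)%N
    then (mu p.1 q.1)@_c1 * (mu p.2 q.2)@_c2 else 0); last first.
    by case: ifP => // _; rewrite big1 // => p _; rewrite big1.
  apply: eq_big_seq => -[a1 a2]; rewrite mem_splits => /eqP <-.
  apply: eq_big_seq => -[b1 b2]; rewrite mem_splits => /eqP <- /=.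
  rewrite !nu_diag !mu'E.
  have [->|] := eqVneq ((mu a1 b1)@_c1) 0; first by rewrite !if_same !mul0r if_same.
  rewrite mcoeff_neq0 => /nu_supp h1.
  have [->|] := eqVneq ((mu a2 b2)@_c2) 0; first by rewrite !if_same !mulr0 if_same.
  rewrite mcoeff_neq0 => /nu_supp h2.
  by case: eqP => k1; case: eqP => k2; case: eqP => k3; rewrite ?mul0r ?mulr0 //; lia.
- move=> a b c; rewrite -mcoeff_neq0 mu'E; case: ifP => _; rewrite ?eqxx //.
  by rewrite mcoeff_neq0; exact: mu_graded.
Qed.

End TopComponent.

(** * Quasi-shuffles and shuffles as sums over factorizations *)

Section MergeSums.
Context (d : nat) (K : comNzRingType).
Local Notation M := (cmonom 'I_d).
Local Notation eps := (@mone M).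
Local Notation C := (mcomp d).
Local Notation H := {malg K[C]}.
Local Notation e := (cempty d).

Lemma mkcomp_eq m n (A B : 'M[M]_(m, n)) hA hB :
  A = B -> mkcomp (A := A) hA = mkcomp (A := B) hB.
Proof. by move=> AB; apply: val_inj => /=; rewrite AB. Qed.

Lemma mkcomp_comp_mx (c : C) (A : 'M[M]_(nrow c, ncol c)) hA :
  (mkcomp (A := A) hA == c) = (A == comp_mx c).
Proof.
apply/eqP/eqP => [E|E].
  apply/matrixP => i j.
  have h : entry (mkcomp hA) i j = A i j := entryE (c := mkcomp hA) i j.
  by rewrite -h E (entryE (c := c)).
apply: val_inj => /=; rewrite E.
by case: c {A hA E} => -[[m n] A] h.
Qed.

(** The off-diagonal blocks only contribute neutral elements. *)
Lemma merge_mx_diag m n s t j k (A : 'M[M]_(m, n)) (B : 'M[M]_(s, t))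
    (p : 'I_(m + s) -> 'I_j) (q : 'I_(n + t) -> 'I_k) :
  merge_mx (diag_mx2 A B) p q =
  mxmmul (merge_mx A (p \o @lshift m s) (q \o @lshift n t))
         (merge_mx B (p \o @rshift m s) (q \o @rshift n t)).
Proof.
apply/matrixP => x y; rewrite !mxE big_split_ord /=.
congr (mmul _ _); apply: eq_bigr => u _; rewrite big_split_ord /=.
  rewrite [X in mmul _ X]big1 => [|v _]; last by rewrite block_mxEur mxE.
  by rewrite mulm1; apply: eq_bigr => v _; rewrite block_mxEul.
rewrite [X in mmul X _]big1 => [|v _]; last by rewrite block_mxEdl mxE.
by rewrite mul1m; apply: eq_bigr => v _; rewrite block_mxEdr.
Qed.

Lemma incr_blocksP m s k (f : 'I_(m + s) -> 'I_k) :
  reflect (incr (f \o @lshift m s) /\ incr (f \o @rshift m s)) (incr_blocks f).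
Proof.
apply: (iffP andP) => -[h1 h2]; split.
- by move=> u v uv; apply: (implyP (forallP (forallP h1 u) v)).
- by move=> u v uv; apply: (implyP (forallP (forallP h2 u) v)).
- by apply/forallP => u; apply/forallP => v; apply/implyP => /h1.
- by apply/forallP => u; apply/forallP => v; apply/implyP => /h2.
Qed.

Lemma emb_inj m n j k (al : 'I_m -> 'I_j) (be : 'I_n -> 'I_k) A (Z Z' : 'M[M]_(j, k)) :
  emb al be A Z -> emb al be A Z' -> Z = Z'.
Proof.
move=> h h'; apply/matrixP => x y.
have [hx|/h.2[[u <-] [v <-]]] := eqVneq (Z x y) eps; last by rewrite h.1 h'.1.
have [->//|/h'.2[[u <-] [v <-]]] := eqVneq (Z' x y) eps; by rewrite h.1 h'.1.
Qed.

Section Fixed.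
Variables (a b : C) (j k : nat) (Z : 'M[M]_(j, k)).
Local Notation P := (qsh (nrow a) (nrow b) j).
Local Notation Q := (qsh (ncol a) (ncol b) k).
Implicit Types (r : P * Q).

Lemma qsh_incr m s i (p : qsh m s i) :
  incr (val p \o @lshift m s) /\ incr (val p \o @rshift m s).
Proof. exact/incr_blocksP/(andP (valP p)).1. Qed.

Definition factors r : 'M[M]_(j, k) * 'M[M]_(j, k) :=
  (merge_mx (comp_mx a) (val r.1 \o @lshift _ _) (val r.2 \o @lshift _ _),
   merge_mx (comp_mx b) (val r.1 \o @rshift _ _) (val r.2 \o @rshift _ _)).

Lemma factors_emb r :
  emb (val r.1 \o @lshift _ _) (val r.2 \o @lshift _ _) (comp_mx a) (factors r).1 /\
  emb (val r.1 \o @rshift _ _) (val r.2 \o @rshift _ _) (comp_mx b) (factors r).2.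
Proof.
have [h1 h2] := qsh_incr r.1; have [h3 h4] := qsh_incr r.2.
by split; apply: emb_merge_mx; apply: incr_inj.
Qed.

Lemma factors_inj : injective factors.
Proof.
move=> r r' E; have [h1 h2] := qsh_incr r.1; have [h3 h4] := qsh_incr r.2.
have [h1' h2'] := qsh_incr r'.1; have [h3' h4'] := qsh_incr r'.2.
have [ea eb] := factors_emb r; have [ea' eb'] := factors_emb r'.
rewrite -E in ea' eb'.
have [_ p1 q1] := emb_uniq h1 h3 ea h1' h3' ea'.
have [_ p2 q2] := emb_uniq h2 h4 eb h2' h4' eb'.
rewrite [r]surjective_pairing [r']surjective_pairing.
congr (_, _); apply/val_inj/ffunP => u; case: (split_ordP u) => v ->.
- exact: p1.
- exact: p2.
- exact: q1.
- exact: q2.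
Qed.

Definition glue m s i (al : 'I_m -> 'I_i) (al' : 'I_s -> 'I_i) :
    {ffun 'I_(m + s) -> 'I_i} :=
  [ffun u => match split u with inl v => al v | inr v => al' v end].

Lemma glue_lshift m s i (al : 'I_m -> 'I_i) (al' : 'I_s -> 'I_i) :
  glue al al' \o @lshift m s = al.
Proof.
by apply: funext => u; rewrite /= ffunE -[lshift s u]/(unsplit (inl u)) unsplitK.
Qed.

Lemma glue_rshift m s i (al : 'I_m -> 'I_i) (al' : 'I_s -> 'I_i) :
  glue al al' \o @rshift m s = al'.
Proof.
by apply: funext => u; rewrite /= ffunE -[rshift m u]/(unsplit (inr u)) unsplitK.
Qed.

Lemma glue_qsh m s i (al : 'I_m -> 'I_i) (al' : 'I_s -> 'I_i) :
  incr al -> incr al' ->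
  (forall x, (exists u, al u = x) \/ (exists u, al' u = x)) ->
  incr_blocks (glue al al') && surjb (glue al al').
Proof.
move=> h h' s_al; apply/andP; split.
  by apply/incr_blocksP; rewrite glue_lshift glue_rshift.
apply/forallP => x; apply/existsP; case: (s_al x) => -[u <-].
  by exists (lshift s u); rewrite -[X in X == _]/((glue al al' \o @lshift m s) u) glue_lshift.
by exists (rshift m u); rewrite -[X in X == _]/((glue al al' \o @rshift m s) u) glue_rshift.
Qed.

Hypothesis hZ : no_eps_line Z.

(** The map factors is a bijection from the pairs of quasi-shuffles that merge to Z
    onto the factorizations of Z counted by factor_count. Its inverse glues the
    two embeddings; the result is surjective because each line of Z has a
    nontrivial entry, hence meets a line of one of the factors. *)
Lemma sum_merge :
  \sum_(p : P) \sum_(q : Q)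
    (merge_mx (comp_mx (diag a b)) (val p) (val q) == Z)%:R = factor_count K a b Z.
Proof.
rewrite pair_big /=.
rewrite (eq_bigr (fun r => if mxmmul (factors r).1 (factors r).2 == Z then 1 else 0));
  last first.
  move=> r _; rewrite [comp_mx _]/(diag_mx2 _ _) merge_mx_diag.
  by rewrite -mulrb.
rewrite -big_mkcond /= -big_filter /factor_count.
under [RHS]eq_bigr do rewrite mulrb.
rewrite -[RHS]big_mkcond /= -[RHS]big_filter.
set s := [seq r <- _ | _]; set t := [seq p <- _ | _].
rewrite (perm_big [seq factors r | r <- s]) /=; first by rewrite big_map.
apply: uniq_perm.
- exact/filter_uniq/uniq_factorizations.
- by rewrite (map_inj_uniq factors_inj) filter_uniq // index_enum_uniq.
move=> [X Y]; rewrite mem_filter mem_factorizations; apply/idP/mapP => /=.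
  move=> /andP[/andP[/eqP hX /eqP hY] /eqP hXY].
  have [al [be [ial ibe hal]]] : is_comp a X by rewrite -hX; exact: compressP.
  have [al' [be' [ial' ibe' hal']]] : is_comp b Y by rewrite -hY; exact: compressP.
  have [rZ cZ] := no_eps_lineP _ hZ.
  have im x y : Z x y != eps ->
      ((exists u, al u = x) \/ (exists u, al' u = x)) /\
      ((exists v, be v = y) \/ (exists v, be' v = y)).
    move=> h; have [X1|] := eqVneq (X x y) eps; last first.
      by move/hal.2 => [hu hv]; split; left.
    have : Y x y != eps by rewrite -hXY mxE X1 mul1m in h.
    by move/hal'.2 => [hu hv]; split; right.
  have hp : incr_blocks (glue al al') && surjb (glue al al').
    by apply: glue_qsh => // x; have [y /im[]] := rZ x.
  have hq : incr_blocks (glue be be') && surjb (glue be be').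
    by apply: glue_qsh => // y; have [x /im[]] := cZ y.
  (* The pair of quasi-shuffles with prescribed embeddings of both factors. *)
  pose r : P * Q := (exist _ (glue al al') hp, exist _ (glue be be') hq).
  have fr : factors r = (X, Y).
    rewrite /factors /= !glue_lshift !glue_rshift.
    by congr (_, _); [apply: emb_inj hal | apply: emb_inj hal'];
      apply: emb_merge_mx; apply: incr_inj.
  exists r => //; rewrite mem_filter mem_index_enum andbT.
  by rewrite -[X in X == _]/(mxmmul (factors r).1 (factors r).2) fr hXY.
move=> [r]; rewrite mem_filter => /andP[/eqP h' _] hXY.
have h : mxmmul X Y = Z.
  by move: h'; rewrite -[X in X = _]/(mxmmul (factors r).1 (factors r).2) -hXY.
have [e1 e2] := factors_emb r; rewrite -hXY /= in e1 e2.
have [h1 h2] := qsh_incr r.1; have [h3 h4] := qsh_incr r.2.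
rewrite h eqxx andbT; apply/andP; split; apply/eqP; apply: compress_eq.
  by exists (val r.1 \o @lshift _ _), (val r.2 \o @lshift _ _).
by exists (val r.1 \o @rshift _ _), (val r.2 \o @rshift _ _).
Qed.

End Fixed.

Lemma sum_merge_diag (a b c : C) j k :
  \sum_(p : qsh (nrow a) (nrow b) j) \sum_(q : qsh (ncol a) (ncol b) k)
    (merge_diag p q == c)%:R =
  if (j == nrow c) && (k == ncol c) then factor_count K a b (comp_mx c) else 0.
Proof.
have [->|jc] /= := eqVneq j (nrow c); last first.
  rewrite big1 // => p _; rewrite big1 // => q _; case: eqP => // E.
  by rewrite -E eqxx in jc.
have [->|kc] /= := eqVneq k (ncol c); last first.
  rewrite big1 // => p _; rewrite big1 // => q _; case: eqP => // E.
  by rewrite -E eqxx in kc.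
rewrite -sum_merge; last exact: comp_mxP.
by apply: eq_bigr => p _; apply: eq_bigr => q _; rewrite mkcomp_comp_mx.
Qed.

Definition qshuffle_basis (a b : C) : H :=
  if a == e then << b >> else if b == e then << a >> else
  \sum_(1 <= j < (nrow a + nrow b).+1) \sum_(1 <= k < (ncol a + ncol b).+1)
     \sum_(p : qsh (nrow a) (nrow b) j) \sum_(q : qsh (ncol a) (ncol b) k)
        << merge_diag p q >>.

Definition shuffle_basis (a b : C) : H :=
  if a == e then << b >> else if b == e then << a >> else
  \sum_(p in sh (nrow a) (nrow b)) \sum_(q in sh (ncol a) (ncol b))
     << perm_diag p q >>.

Lemma sum_nat_eq (V : nmodType) (N n : nat) (x : V) :
  \sum_(1 <= j < N) (if j == n then x else 0) = if (0 < n < N)%N then x else 0.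
Proof.
case: ifP => h; last first.
  rewrite big1_seq // => j /andP[_]; rewrite mem_index_iota => hj.
  by case: eqP => // E; rewrite -E hj in h.
rewrite (bigD1_seq n) ?mem_index_iota ?iota_uniq //= eqxx big1 ?addr0 // => j.
by move/negPf->.
Qed.

Lemma nrow_gt0 (c : C) : c != e -> (0 < nrow c)%N.
Proof. by rewrite lt0n; apply: contra => /eqP/nrow_eq0->. Qed.

Lemma ncol_gt0 (c : C) : c != e -> (0 < ncol c)%N.
Proof.
move=> /nrow_gt0 h; have [y hy _] := row_entry h; exact: leq_ltn_trans hy.
Qed.

Lemma qshuffle_basis_count a b c : (qshuffle_basis a b)@_c = factor_count K a b (comp_mx c).
Proof.
rewrite /qshuffle_basis; have [->|a0] := eqVneq a e; first by rewrite factor_count_unit mcoeffU.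
have [->|b0] := eqVneq b e; first by rewrite factor_countC factor_count_unit mcoeffU.
rewrite raddf_sum (eq_bigr (fun j => if j == nrow c then
  if (0 < ncol c < (ncol a + ncol b).+1)%N then factor_count K a b (comp_mx c) else 0
  else 0)); last first.
  move=> j _; rewrite raddf_sum.
  rewrite (eq_bigr (fun k => if k == ncol c then
     if j == nrow c then factor_count K a b (comp_mx c) else 0 else 0)); last first.
    move=> k _; rewrite raddf_sum.
    under eq_bigr do (rewrite raddf_sum /=; under eq_bigr do rewrite mcoeffU).
    by rewrite sum_merge_diag andbC; case: eqP; case: eqP.
  by rewrite sum_nat_eq; case: ifP; case: ifP.
rewrite sum_nat_eq; have [->|/factor_count_bounds[h1 h2 h3 h4]] := eqVneq (factor_count K a b (comp_mx c)) 0.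
  by rewrite !if_same.
have := nrow_gt0 a0; have := ncol_gt0 a0 => hc hr.
by rewrite !ltnS h3 h4 (leq_trans hr h1) (leq_trans hc h2).
Qed.

Lemma qsh_injective m s (p : qsh m s (m + s)) : injective (val p).
Proof.
have /forallP hs := (andP (valP p)).2.
have im : val p @: setT = setT.
  apply/setP => x; rewrite inE; apply/imsetP.
  by have /existsP[u /eqP <-] := hs x; exists u; rewrite ?inE.
suff /imset_injP inj : #|val p @: setT| == #|[set: 'I_(m + s)]|.
  by move=> u v; apply: inj; rewrite inE.
by rewrite im.
Qed.

(** A surjective map between finite sets of equal size is a permutation. *)
Definition perm_of_qsh m s (p : qsh m s (m + s)) : 'S_(m + s) :=
  perm (@qsh_injective m s p).

Lemma perm_of_qsh_inj m s : injective (@perm_of_qsh m s).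
Proof.
move=> p p' /permP E; apply/val_inj/ffunP => u.
by have := E u; rewrite !permE.
Qed.

Lemma incr_blocks_perm m s (p : 'S_(m + s)) :
  incr_blocks (finfun p : {ffun _ -> _}) = incr_blocks p.
Proof.
rewrite /incr_blocks; congr (_ && _);
  by apply: eq_forallb => u; apply: eq_forallb => v; rewrite !ffunE.
Qed.

Lemma perm_of_qsh_sh m s (p : qsh m s (m + s)) : perm_of_qsh p \in sh m s.
Proof.
rewrite inE -incr_blocks_perm.
have -> : finfun (perm_of_qsh p) = val p by apply/ffunP => u; rewrite ffunE permE.
exact: (andP (valP p)).1.
Qed.

Lemma sh_perm_of_qsh m s (p : 'S_(m + s)) : p \in sh m s ->
  exists p', perm_of_qsh p' = p.
Proof.
rewrite inE => hp.
have h : incr_blocks (finfun p : {ffun _ -> _}) && surjb (finfun p : {ffun _ -> _}).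
  rewrite incr_blocks_perm hp; apply/forallP => x; apply/existsP.
  by exists (p^-1 x)%g; rewrite ffunE permKV.
pose p' : qsh m s (m + s) := exist _ (finfun p) h.
by exists p'; apply/permP => u; rewrite permE /= ffunE.
Qed.

Lemma big_sh (V : nmodType) m s (F : 'S_(m + s) -> V) :
  \sum_(p in sh m s) F p = \sum_(p : qsh m s (m + s)) F (perm_of_qsh p).
Proof.
rewrite -big_filter.
rewrite (perm_big [seq perm_of_qsh p | p <- index_enum (qsh m s (m + s))]) /=.
  by rewrite big_map.
apply: uniq_perm; first by rewrite filter_uniq // index_enum_uniq.
  by rewrite (map_inj_uniq (@perm_of_qsh_inj m s)) index_enum_uniq.
move=> p; rewrite mem_filter mem_index_enum andbT; apply/idP/mapP.
  by move/sh_perm_of_qsh => [p' <-]; exists p'; rewrite ?mem_index_enum.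
by case=> p' _ ->; exact: perm_of_qsh_sh.
Qed.

Lemma perm_diag_merge (a b : C) (p : qsh (nrow a) (nrow b) (nrow a + nrow b))
    (q : qsh (ncol a) (ncol b) (ncol a + ncol b)) :
  perm_diag (perm_of_qsh p) (perm_of_qsh q) = merge_diag p q.
Proof.
apply: mkcomp_eq; apply/matrixP => x y; rewrite mxE.
set u := ((perm_of_qsh p)^-1)%g x; set v := ((perm_of_qsh q)^-1)%g y.
have -> : x = val p u by rewrite -[RHS](permE (@qsh_injective _ _ p)) permKV.
have -> : y = val q v by rewrite -[RHS](permE (@qsh_injective _ _ q)) permKV.
have := emb_merge_mx (comp_mx (diag a b)) (@qsh_injective _ _ p) (@qsh_injective _ _ q).
by move=> [-> _].
Qed.

(** Shuffles are the quasi-shuffles onto as many lines as there are in the two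
    factors together. *)
Lemma shuffle_basis_top a b c : (shuffle_basis a b)@_c =
  if csize c == (csize a + csize b)%N then (qshuffle_basis a b)@_c else 0.
Proof.
have s0 : csize e = 0%N by [].
rewrite /shuffle_basis /qshuffle_basis; have [->|a0] := eqVneq a e.
  rewrite s0 add0n mcoeffU; case: eqP => [->|_]; first by rewrite eqxx.
  by rewrite if_same.
have [->|b0] := eqVneq b e.
  rewrite s0 addn0 mcoeffU; case: eqP => [->|_]; first by rewrite eqxx.
  by rewrite if_same.
have := qshuffle_basis_count a b c; rewrite /qshuffle_basis (negPf a0) (negPf b0) => ->.
rewrite big_sh raddf_sum.
under eq_bigr => p _.
  rewrite big_sh raddf_sum /=.
  under eq_bigr do rewrite perm_diag_merge mcoeffU.
  over.
rewrite sum_merge_diag.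
have [->|/factor_count_bounds[_ _ h1 h2]] := eqVneq (factor_count K a b (comp_mx c)) 0.
  by rewrite !if_same.
rewrite /csize; case: andP => [[/eqP h3 /eqP h4]|H]; case: eqP => // h.
  by case: h; rewrite -h3 -h4 addnACA.
by case: H; split; apply/eqP; lia.
Qed.

End MergeSums.

(** * The isomorphisms *)

Section MatrixCompositionAlgebras.
Context (d : nat) (K : comAlgType rat).
Local Notation one := (<< cempty d >> : {malg K[mcomp d]}).

Definition rat_inv (n : nat) : K := (n%:R^-1 : rat)%:A.

Lemma rat_invK n : n != 0%N -> rat_inv n * n%:R = 1.
Proof.
move=> n0; rewrite /rat_inv mulr_algl -[X in _ *: X]scaler_nat scalerA.
by rewrite mulVf ?scale1r // Num.Theory.pnatr_eq0.
Qed.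

Definition block_shuffle_basis (a b : mcomp d) : {malg K[mcomp d]} :=
  word_shuffle K (components a) (components b).

Lemma block_shuffle_basis_like : @block_shuffle_like d K block_shuffle_basis.
Proof.
have nil c : word_shuffle K [::] (components c) = << c >>.
  by rewrite -[in RHS](bigdiag_components c); case: (components c).
split.
- by move=> c; rewrite /block_shuffle_basis components_cempty nil.
- move=> c; rewrite /block_shuffle_basis components_cempty.
  by rewrite -[in RHS](bigdiag_components c); case: (components c).
- by move=> a b u v ha hb; rewrite /block_shuffle_basis !components_diag.
Qed.

Lemma shuffle_like_qshuffle : shuffle_like (@cdeg d) (@qshuffle_basis d K).
Proof. exact/shuffle_like_factor_count/qshuffle_basis_count. Qed.

Lemma shuffle_like_shuffle : shuffle_like (@cdeg d) (@shuffle_basis d K).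
Proof.
apply: (shuffle_like_top shuffle_like_qshuffle (@csize_diag d)).
  exact: (csize_supp (@qshuffle_basis_count d K)).
exact: shuffle_basis_top.
Qed.

Lemma two_shuffle_block_shuffle :
  alg_isomorphic (@two_shuffle d K) one (@block_shuffle d K) one.
Proof.
exact: (shuffle_like_iso rat_invK shuffle_like_shuffle (@cdeg_eq0 d) block_shuffle_basis_like).
Qed.

Lemma two_qshuffle_block_shuffle :
  alg_isomorphic (@two_qshuffle d K) one (@block_shuffle d K) one.
Proof.
exact: (shuffle_like_iso rat_invK shuffle_like_qshuffle (@cdeg_eq0 d) block_shuffle_basis_like).
Qed.

End MatrixCompositionAlgebras.

Theorem corollary3p13 (K : comAlgType rat) (d : nat) (hd : (0 < d)%N) :
  let one : {malg K[mcomp d]} := << cempty d >> in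
  alg_isomorphic (@block_shuffle d K) one (@two_shuffle d K) one /\
  alg_isomorphic (@two_shuffle d K) one (@two_qshuffle d K) one.
Proof.
move=> one; split; first exact/alg_isomorphic_sym/two_shuffle_block_shuffle.
exact: (alg_isomorphic_trans (two_shuffle_block_shuffle d K)
         (alg_isomorphic_sym (two_qshuffle_block_shuffle d K))).
Qed.
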